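(* Let $\alpha,\beta\in\mathbb{Q}\setminus\{0,1\}$. \begin{enumerate} \item[(1)] If $\rho(\alpha)\neq\rho(\beta)$, then $T(\alpha,\beta)=\emptyset$. \item[(2)] If $\alpha\equiv 3 \bmod 4$ and $\beta\equiv 1\bmod 4$, then $T(\alpha,\beta)\subseteq\{\alpha^2,\beta\}$. \item[(3)] If $\alpha\equiv 2\bmod 4$ and $\beta\equiv 0\bmod 4$, then $T(\alpha,\beta)\subseteq\{\alpha(2-\alpha),\beta\}$. \item[(4)] If $v(\alpha)=-1$ and $v(\beta)\le -2$, then $T(\alpha,\beta)\subseteq\{\alpha^2/(2\alpha-1),\beta\}$. \end{enumerate}
   Context: For $\lambda \in \mathbb{C}\setminus\{0,1\}$ let $E_\lambda \colon y^2 = x(x-1)(x-\lambda)$. For $\alpha \in \mathbb{C}\setminus\{0,1\}$ let $P_\alpha(\lambda)$ be a point on $E_\lambda$ with $x$-coordinate $\alpha$ (well defined up to sign), and set $T(\alpha) = \{\lambda \in \mathbb{C}\setminus\{0,1\} : P_\alpha(\lambda) \text{ is a torsion point of } E_\lambda\}$ and $T(\alpha,\beta) = T(\alpha)\cap T(\beta)$. Here $v$ is the $2$-adic valuation on $\mathbb{Q}$ with $v(2)=1$, and $\rho\colon\mathbb{Q}\to\mathbb{P}^1(\mathbb{F}_2)=\{0,1,\infty\}$ is reduction modulo $2$ ($\rho(\alpha)=\infty$ iff $v(\alpha)<0$). Congruences modulo $4$ are in the ring $\mathbb{Z}_{(2)}$ of rational numbers with odd denominator; in particular they imply that the number is $2$-integral.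 In (4), if $\alpha=1/2$ the expression $\alpha^2/(2\alpha-1)$ is to be omitted from the set. *)

(* Defs.v *)
From mathcomp Require Import all_boot all_order all_algebra.
From mathcomp Require Import classical_sets reals complex.

Set Implicit Arguments.
Unset Strict Implicit.
Unset Printing Implicit Defensive.

Import Order.TTheory GRing.Theory Num.Theory.

Local Open Scope ring_scope.

Section LegendreCurve.
Variable F : fieldType.

(* The affine plane with one extra point [None], which stands for the point   *)
(* at infinity of the Legendre curve, the neutral element of its group law.   *)
Definition legendre_point : Type := option (F * F).

Definition on_legendre (l : F) (P : legendre_point) : bool :=
  if P is Some (x, y) then y ^+ 2 == x * (x - 1) * (x - l) else true.

(* Chord-tangent addition on y^2 = x^3 - (1 + l) x^2 + l x; only meaningful   *)
(* on points satisfying [on_legendre l]. Negation is (x, y) |-> (x, - y), so  *)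
(* doubling a point with y = 0 falls under the branch [y1 == - y2], and on    *)
(* the curve x1 = x2 with y1 != - y2 forces y1 = y2 != 0.                     *)
Definition legendre_add (l : F) (P Q : legendre_point) : legendre_point :=
  match P, Q with
  | None, _ => Q
  | _, None => P
  | Some (x1, y1), Some (x2, y2) =>
    if (x1 == x2) && (y1 == - y2) then None else
    let m := if x1 == x2
             then (x1 ^+ 2 *+ 3 - (1 + l) * x1 *+ 2 + l) / (y1 *+ 2)
             else (y2 - y1) / (x2 - x1) in
    let x3 := m ^+ 2 + (1 + l) - x1 - x2 in
    Some (x3, m * (x1 - x3) - y1)
  end.

Definition legendre_mul (l : F) (n : nat) (P : legendre_point) :
    legendre_point :=
  iter n (legendre_add l P) None.

Definition legendre_torsion (l : F) (P : legendre_point) : Prop :=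
  exists2 n : nat, (0 < n)%N & legendre_mul l n P = None.

End LegendreCurve.

Section TorsionParameters.
Local Open Scope classical_set_scope.
Variable R : realType.

(* The point with x-coordinate [a] is unique up to sign, so quantifying its   *)
(* y-coordinate existentially or universally makes no difference.             *)
Definition torsion_params (a : R[i]) : set R[i] :=
  [set l | [/\ l != 0, l != 1 &
    exists y : R[i], on_legendre l (Some (a, y)) /\
                     legendre_torsion l (Some (a, y))]].

Definition common_torsion_params (a b : R[i]) : set R[i] :=
  torsion_params a `&` torsion_params b.

End TorsionParameters.

(* The 2-adic valuation of a nonzero rational; [v2 0] is the junk value 0.    *)
Definition v2 (a : rat) : int :=
  (logn 2 `|numq a|)%:Z - (logn 2 `|denq a|)%:Z.

(* Reduction to the projective line over the field with two elements; [None]  *)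
(* is the point at infinity. [ratr a] is numq a / denq a computed in 'F_2,    *)
(* and the denominator is nonzero there when [a] is 2-integral.               *)
Definition rho (a : rat) : option 'F_2 :=
  if v2 a < 0 then None else Some (ratr a).

Definition Z_loc2 : pred rat := [pred a | odd `|denq a|].

Definition eq_mod4 (a b : rat) : Prop :=
  [/\ a \in Z_loc2, b \in Z_loc2 & exists2 t, t \in Z_loc2 & a - b = 4 * t].

(* Main.v *)
Require Import Defs.
From mathcomp Require Import all_boot all_order all_algebra.
From mathcomp Require Import classical_sets reals complex.
From mathcomp Require Import boolp ring zify.
From Stdlib Require Import Setoid Morphisms.

(** A torsion point P of y^2 = x(x-1)(x-l) has only finitely many multiples, so
    the numbers x(P), x(2P), x(4P) and so on, which are obtained from x(P) by
    iterating the rational map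
      x |-> dbl x = (x^2 - l)^2 / (4 x (x-1) (x-l)),
    stay in a finite set, as long as they avoid the x-coordinates 0, 1, l of the
    points of order 2. Now extend the 2-adic absolute value of the rationals to
    the complex numbers. If |x| > max(1, |l|), then |dbl x| = |x/4| > |x|, and
    the same applies to dbl x; the iterates of x thus grow for ever. Hence the
    torsion points satisfy |x| <= max(1, |l|) (torsion_x_bounded), and
    everything follows by applying this bound to x(P), x(2P) and x(4P).

    - The bound for x(2P), or for x(P) when |a| > 1, shows that if the point
      with x-coordinate a is torsion, then l has the same reduction as a in
      P^1 (torsion_odd, torsion_even, torsion_pole). Two rational numbers with a
      common parameter l therefore have the same reduction.

    - The three lemmas with suffix _sharp go one step further. For a reducing to
      1, the bound for x(4P) says that x(2P) is a unit, unless 2P is the point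
      (0,0), that is l = a^2. The equation x(2P) = dbl a then determines
      |l - a^2|: it is |2(a-1)|, unless l = a. The other reductions are treated
      in the same way, with (1,0) and (l,0) as exceptional points.

    - In each of the last three assertions, b is closer than a to 0, 1 or
      infinity, and the equalities of absolute values that come from a and from
      b contradict each other, outside the listed exceptional values of l
      (common_odd, common_even, common_pole).

    This rests on two ingredients. The passage from the multiples nP to
    duplication needs the associativity of the chord-tangent law; it is proved
    from the description of P + Q + R = 0 as the intersection of the curve with
    a line, which does not distinguish chords from tangents. The absolute value
    is replaced by a valuation ring of the complex numbers in which 2 is not
    invertible. Such a ring exists by Zorn's lemma, the argument being that of
    Chevalley's extension theorem; its value group is only ever used through
    divisibility, where x <=v y means that x is a multiple of y. *)

Set Implicit Arguments.
Unset Strict Implicit.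
Unset Printing Implicit Defensive.

Import Order.TTheory GRing.Theory Num.Theory.

Local Open Scope ring_scope.

(** * Linear combinations of equations *)

Section LinearCombination.
Variable F : comRingType.
Implicit Types x y a b c : F.

(** These lemmas derive an equation from a linear combination, with explicit
    coefficients, of known equations, which leaves an identity to [ring]. *)
Lemma lincomb1 x y a1 b1 c1 :
  a1 = b1 -> x - y = c1 * (a1 - b1) -> x = y.
Proof. by move=> -> e; apply/eqP; rewrite -subr_eq0 e subrr mulr0. Qed.

Lemma lincomb2 x y a1 b1 a2 b2 c1 c2 :
  a1 = b1 -> a2 = b2 -> x - y = c1 * (a1 - b1) + c2 * (a2 - b2) -> x = y.
Proof.
by move=> -> h e; apply: (lincomb1 (c1 := c2) h); rewrite e subrr mulr0 add0r.
Qed.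

Lemma lincomb3 x y a1 b1 a2 b2 a3 b3 c1 c2 c3 :
    a1 = b1 -> a2 = b2 -> a3 = b3 ->
  x - y = c1 * (a1 - b1) + c2 * (a2 - b2) + c3 * (a3 - b3) -> x = y.
Proof.
move=> -> h2 h3 e; apply: (lincomb2 (c1 := c2) (c2 := c3) h2 h3).
by rewrite e subrr mulr0 add0r.
Qed.

Lemma lincomb4 x y a1 b1 a2 b2 a3 b3 a4 b4 c1 c2 c3 c4 :
    a1 = b1 -> a2 = b2 -> a3 = b3 -> a4 = b4 ->
  x - y = c1 * (a1 - b1) + c2 * (a2 - b2) + c3 * (a3 - b3) + c4 * (a4 - b4) ->
  x = y.
Proof.
move=> -> h2 h3 h4 e.
apply: (lincomb3 (c1 := c2) (c2 := c3) (c3 := c4) h2 h3 h4).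
by rewrite e subrr mulr0 add0r.
Qed.

End LinearCombination.

(** * The group law *)

Section GroupLaw.
Variables (F : fieldType) (l : F).
Hypotheses (two_neq0 : 2 != 0 :> F) (l_neq0 : l != 0) (l_neq1 : l != 1).

Local Notation point := (legendre_point F).
Local Notation "P +% Q" :=
  (legendre_add l P Q) (at level 50, left associativity).

(** The line y = m x + k cuts the curve in P, Q, R counted with multiplicity:
    the last three equations compare the coefficients in
      x(x-1)(x-l) - (m x + k)^2 = (x - P.1)(x - Q.1)(x - R.1). *)
Definition cut (P Q R : F * F) (m k : F) : Prop :=
  [/\ P.2 = m * P.1 + k, Q.2 = m * Q.1 + k & R.2 = m * R.1 + k] /\
  [/\ P.1 + Q.1 + R.1 = m ^+ 2 + (1 + l),
      P.1 * Q.1 + Q.1 * R.1 + R.1 * P.1 = l - m * k *+ 2 &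
      P.1 * Q.1 * R.1 = k ^+ 2].

Definition neg (P : F * F) := (P.1, - P.2).

Lemma negK : involutive neg.
Proof. by case=> x y; rewrite /neg /= opprK. Qed.

Lemma cutC P Q R m k : cut P Q R m k -> cut Q P R m k.
Proof.
move=> [[hP hQ hR] [e1 e2 e3]]; split; split => //.
- by rewrite -e1; ring.
- by rewrite -e2; ring.
- by rewrite -e3; ring.
Qed.

Lemma cut_rot P Q R m k : cut P Q R m k -> cut Q R P m k.
Proof.
move=> [[hP hQ hR] [e1 e2 e3]]; split; split => //.
- by rewrite -e1; ring.
- by rewrite -e2; ring.
- by rewrite -e3; ring.
Qed.

Lemma cut_neg P Q R m k :
  cut P Q R m k -> cut (neg P) (neg Q) (neg R) (- m) (- k).
Proof.
move=> [[hP hQ hR] [e1 e2 e3]]; split; split; rewrite /= ?hP ?hQ ?hR.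
- by ring.
- by ring.
- by ring.
- by rewrite e1; ring.
- by rewrite e2; ring.
- by rewrite e3; ring.
Qed.

Lemma cut_on P Q R m k : cut P Q R m k -> on_legendre l (Some P).
Proof.
case: P => a ya [[/= -> _ _] [e1 e2 e3]]; apply/eqP.
apply: (lincomb3 (c1 := - a ^+ 2) (c2 := a) (c3 := -1) e1 e2 e3); ring.
Qed.

Lemma on_legendre_neg P :
  on_legendre l (Some P) -> on_legendre l (Some (neg P)).
Proof. by case: P => x y /=; rewrite sqrrN. Qed.

Lemma legendre_add0r P : None +% P = P.
Proof. by []. Qed.

Lemma legendre_addr0 P : P +% None = P.
Proof. by case: P => // -[]. Qed.

(** The addition formula chooses R.1 so that x(x-1)(x-l) - (m x + k)^2 and
    (x - P.1)(x - Q.1)(x - R.1) have the same coefficient of x^2. Their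
    difference then has degree at most 1, and it vanishes at P.1 and Q.1, doubly
    when P = Q. *)
Lemma legendre_add_cut P Q : on_legendre l (Some P) -> on_legendre l (Some Q) ->
  Q != neg P ->
  exists R m k, Some P +% Some Q = Some (neg R) /\ cut P Q R m k.
Proof.
case: P Q => [a ya] [b yb] /= /eqP oP /eqP oQ nopp.
have [eab | nab] := eqVneq a b.
  subst b.
  have eqy : yb = ya.
    apply/eqP; rewrite -subr_eq0; apply: contraNT nopp => ny.
    rewrite /neg /= xpair_eqE eqxx /= -addr_eq0.
    rewrite -[_ == 0]orFb -(negPf ny) -mulf_eq0.
    by rewrite -subr_sqr oP oQ subrr.
  subst yb.
  have ya0 : ya *+ 2 != 0.
    rewrite -mulr_natl mulf_neq0 //; apply: contraNneq nopp => ya0.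
    by rewrite /neg /= ya0 oppr0.
  have -> : ya == - ya = false by rewrite -addr_eq0 -mulr2n (negPf ya0).
  set m := _ / (ya *+ 2).
  have hm : m * (ya *+ 2) = a ^+ 2 *+ 3 - (1 + l) * a *+ 2 + l.
    by rewrite /m mulfVK.
  move: m hm => m hm.
  set c := m ^+ 2 + (1 + l) - a - a.
  have [k hk] : exists k, ya = m * a + k by exists (ya - m * a); ring.
  exists (c, m * c + k), m, k; split.
    by congr (Some (_, _)); rewrite /= hk /c; ring.
  have e2 : a * a + a * c + c * a = l - m * k *+ 2.
    by apply: (lincomb1 (c1 := 1) hm); rewrite hk /c; ring.
  split; split=> //; first by rewrite /= /c; ring.
  apply: (lincomb2 (c1 := -1) (c2 := a) oP e2); rewrite hk /= /c; ring.
have nba : b - a != 0 by rewrite subr_eq0 eq_sym.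
rewrite /=; set m := (yb - ya) / (b - a).
have hm : m * (b - a) = yb - ya by rewrite /m mulfVK.
move: m hm => m hm.
set c := m ^+ 2 + (1 + l) - a - b.
have [k hk] : exists k, ya = m * a + k by exists (ya - m * a); ring.
have hkb : yb = m * b + k.
  by rewrite -[LHS](subrK ya) -hm hk; ring.
exists (c, m * c + k), m, k; split.
  by congr (Some (_, _)); rewrite /= hk /c; ring.
have e2 : a * b + b * c + c * a = l - m * k *+ 2.
  apply: (mulfI nba); apply: (lincomb2 (c1 := -1) (c2 := 1) oP oQ).
  by rewrite hk hkb /c; ring.
split; split=> //; first by rewrite /= /c; ring.
apply: (lincomb2 (c1 := -1) (c2 := a) oP e2); rewrite hk /= /c; ring.
Qed.

(** Conversely a triple determines its line. When P = Q, the slope is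
    recovered from the derivative of the cubic at P.1, which requires P.2 to be
    nonzero; this holds because the roots 0, 1, l of the cubic are simple. *)
Lemma legendre_add_of_cut P Q R m k :
  cut P Q R m k -> Some P +% Some Q = Some (neg R).
Proof.
move=> h; have oP := cut_on h; have oQ := cut_on (cutC h).
case: h; case: P Q R oP oQ => [a ya] [b yb] [c yc] /eqP oP /eqP oQ.
rewrite /=; move=> [hP hQ hR] [e1 e2 e3].
have -> : c = m ^+ 2 + (1 + l) - a - b by rewrite -e1; ring.
suff [-> ->] : (a == b) && (ya == - yb) = false /\
    (if a == b then (a ^+ 2 *+ 3 - (1 + l) * a *+ 2 + l) / (ya *+ 2)
     else (yb - ya) / (b - a)) = m.
  congr (Some (_, _)); rewrite hR hP /= (_ : c = m ^+ 2 + (1 + l) - a - b).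
    by ring.
  by rewrite -e1; ring.
have [eab | nab] := eqVneq a b; last first.
  split=> //; have nba : b - a != 0 by rewrite subr_eq0 eq_sym.
  by apply: (mulIf nba); rewrite mulfVK // hQ hP; ring.
subst b; have eqy : yb = ya by rewrite hP hQ.
subst yb.
have hm : m * (ya *+ 2) = a ^+ 2 *+ 3 - (1 + l) * a *+ 2 + l.
  apply: (lincomb2 (c1 := - 2 * a) (c2 := 1) e1 e2); rewrite hP; ring.
have ya0 : ya *+ 2 != 0.
  rewrite -mulr_natl mulf_neq0 //; apply/eqP => ya0.
  move: hm oP; rewrite ya0 mul0rn mulr0 expr0n /= => /esym hm /esym/eqP.
  rewrite !mulf_eq0 => /orP[/orP[]|].
  - move/eqP=> a0; move: hm; rewrite a0 => hm.
    by case/eqP: l_neq0; rewrite -hm; ring.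
  - rewrite subr_eq0 => /eqP a1; move: hm; rewrite a1 => hm.
    by case/eqP: l_neq1; apply/esym; apply: (lincomb1 (c1 := 1) hm); ring.
  - rewrite subr_eq0 => /eqP al; move: hm; rewrite al => hm.
    have /eqP : l * (l - 1) = 0 by rewrite -hm; ring.
    by rewrite mulf_eq0 subr_eq0 (negPf l_neq0) (negPf l_neq1).
split; first by rewrite eqy -addr_eq0 -mulr2n (negPf ya0).
by rewrite -hm mulfK.
Qed.

Lemma legendre_addC P Q :
  on_legendre l P -> on_legendre l Q -> P +% Q = Q +% P.
Proof.
case: P Q => [P|] [Q|]; rewrite ?legendre_addr0 ?legendre_add0r // => oP oQ.
have [-> | nopp] := eqVneq Q (neg P).
  by case: P {oP oQ} => a ya; rewrite /= opprK !eqxx.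
have [R [m [k [-> /cutC]]]] := legendre_add_cut oP oQ nopp.
by move=> /legendre_add_of_cut ->.
Qed.

Definition legendre_opp (P : point) : point := omap neg P.

Lemma legendre_oppK : involutive legendre_opp.
Proof. by case=> // P; rewrite /= negK. Qed.

Lemma on_legendre_opp P : on_legendre l P -> on_legendre l (legendre_opp P).
Proof. by case: P => // P; apply: on_legendre_neg. Qed.

Lemma legendre_addrN P : P +% legendre_opp P = None.
Proof. by case: P => // -[a ya]; rewrite /= opprK !eqxx. Qed.

Lemma on_legendre_add P Q :
  on_legendre l P -> on_legendre l Q -> on_legendre l (P +% Q).
Proof.
case: P Q => [P|] [Q|]; rewrite ?legendre_addr0 ?legendre_add0r // => oP oQ.
have [-> | nopp] := eqVneq Q (neg P).
  by rewrite (legendre_addrN (Some P)).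
have [R [m [k [-> /cut_rot/cut_rot/cut_on]]]] :=
  legendre_add_cut oP oQ nopp.
exact: on_legendre_neg.
Qed.

Lemma legendre_opp_add P Q : on_legendre l P -> on_legendre l Q ->
  legendre_opp (P +% Q) = legendre_opp P +% legendre_opp Q.
Proof.
case: P Q => [P|] [Q|]; rewrite ?legendre_addr0 ?legendre_add0r // => oP oQ.
have [-> | nopp] := eqVneq Q (neg P).
  rewrite (legendre_addrN (Some P)).
  exact/esym/(legendre_addrN (Some (neg P))).
have [R [m [k [-> /cut_neg/legendre_add_of_cut]]]] :=
  legendre_add_cut oP oQ nopp.
by rewrite /= => ->.
Qed.

Lemma legendre_addKN P Q :
  on_legendre l P -> on_legendre l Q -> legendre_opp P +% (P +% Q) = Q.
Proof.
case: P Q => [P|] [Q|]; rewrite ?legendre_addr0 ?legendre_add0r // => oP oQ;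
  last first.
  by rewrite legendre_addC ?legendre_addrN // on_legendre_opp.
have [-> | nopp] := eqVneq Q (neg P).
  by rewrite (legendre_addrN (Some P)).
have [R [m [k [-> c]]]] := legendre_add_cut oP oQ nopp.
have /cut_neg/legendre_add_of_cut : cut P R Q m k.
  exact/cutC/cut_rot/cut_rot.
by rewrite negK.
Qed.

(** Let l1, l2, l3 be the linear forms y - m_i x - k_i of the lines through
    P, Q and D = -(P+Q), through Q, R and E = -(Q+R), and through -D, R and
    G = -((P+Q)+R). On the curve, l1 l3 is divisible by x - D.1; the quotient is
    q(x) - M y with M = m1 + m3, and it vanishes at P, Q, R and G. It suffices
    to divide it once more, by l2 / (x - E.1): the result is the linear form of
    a line through P, -E and G, so that G = -(P+(Q+R)). This last division only
    uses that q(x) - M y vanishes at the two points Q and R with distinct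
    x-coordinates; the other lines may be tangents. *)
Lemma legendre_addA_chord P Q R S T :
    on_legendre l (Some P) -> on_legendre l (Some Q) ->
    on_legendre l (Some R) ->
    Q.1 != R.1 -> Some P +% Some Q = Some S -> S != neg R ->
    Some Q +% Some R = Some T -> T != neg P ->
  Some S +% Some R = Some P +% Some T.
Proof.
move=> oP oQ oR nQR eS nSR eT nPT.
have oS : on_legendre l (Some S) by rewrite -eS on_legendre_add.
have [PR | nPR] := eqVneq P R.
  subst R; move: eT; rewrite legendre_addC // eS => -[<-].
  by rewrite legendre_addC.
have nPQ : Q != neg P.
  by apply/eqP=> e; move: eS; rewrite e (legendre_addrN (Some P)).
have nQR' : R != neg Q by apply: contraNneq nQR => ->; case: (Q).
have nRS : R != neg S by rewrite -(inj_eq (can_inj negK)) negK eq_sym.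
have [D [m1 [k1 [eD c1]]]] := legendre_add_cut oP oQ nPQ.
have [E [m2 [k2 [eE c2]]]] := legendre_add_cut oQ oR nQR'.
have [G [m3 [k3 [-> c3]]]] := legendre_add_cut oS oR nRS.
move: eS c3; rewrite eD => -[<-] c3 {S oS nSR nRS}.
move: eT; rewrite eE => -[eT]; subst T.
pose M := m1 + m3.
suff /legendre_add_of_cut : cut P (neg E) G (M - m2) (- M * E.1 - k2) by [].
case: P Q R D E G oP oQ oR nQR nPR c1 c2 c3 {nPQ nQR' eD eE nPT}
  => [a ya] [b yb] [c yc] [d yd] [e ye] [f yf] /= oP oQ oR nbc nPR.
move=> [[/= hP hQ hD] [p1 p2 p3]] [[/= hQ' hR hE] [q1 q2 q3]].
move=> [[/= hD' hR' hG] [r1 r2 r3]].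
(* The form l1 l3 vanishes at both points with x-coordinate d. *)
have hk : k1 + k3 = - M * d.
  by apply: (lincomb2 (c1 := -1) (c2 := -1) hD hD'); rewrite /M; ring.
(* The coefficients of q, computed from l1 (left) and from l3 (right). *)
have t1 : - (a + b) + M * m1 = - (c + f) + M * m3.
  by apply: (lincomb2 (c1 := -1) (c2 := 1) p1 r1); rewrite /M; ring.
have t0 : a * b + M * k1 = c * f + M * k3.
  apply: (lincomb4 (c1 := 1) (c2 := -1) (c3 := m3 - m1) (c4 := d) p2 r2 hk t1).
  by rewrite /M; ring.
(* They also agree with those computed from l2: the difference is a polynomial
   of degree at most 1 in x, with the two roots b and c. *)
have db : b - c != 0 by rewrite subr_eq0.
have u1 : - (a + b) + M * m1 = - (b + c) + M * m2.
  have sb : (- (a + b) + M * m1) * b + (a * b + M * k1) =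
      (- (b + c) + M * m2) * b + (b * c + M * k2).
    by apply: (lincomb2 (c1 := - M) (c2 := M) hQ hQ'); ring.
  have sc : (- (a + b) + M * m1) * c + (a * b + M * k1) =
      (- (b + c) + M * m2) * c + (b * c + M * k2).
    apply: (lincomb4 (c1 := c) (c2 := 1) (c3 := - M) (c4 := M) t1 t0 hR' hR).
    by ring.
  by apply: (mulfI db); apply: (lincomb2 (c1 := 1) (c2 := -1) sb sc); ring.
have u0 : a * b + M * k1 = b * c + M * k2.
  apply: (lincomb3 (c1 := - b) (c2 := - M) (c3 := M) u1 hQ hQ'); ring.
have u1' : a - c = M * (m1 - m2) by apply: (lincomb1 (c1 := -1) u1); ring.
have v : b - f = M * (m2 - m3).
  by apply: (lincomb2 (c1 := -1) (c2 := 1) t1 u1); ring.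
have z : (a - c) * (b - f) = M ^+ 2 * (d - e).
  have -> : d - e = m1 ^+ 2 - m2 ^+ 2 - (a - c).
    by apply: (lincomb2 (c1 := 1) (c2 := -1) p1 q1); ring.
  by rewrite v u1' /M; ring.
(* The cubic minus the square of the fourth line is (x - e)(x - a)(x - f): the
   coefficients of the product of the last two factors. *)
have w1 : - (b + c) + 2 * M * m2 - M ^+ 2 = - (a + f).
  by apply: (lincomb2 (c1 := -2) (c2 := 1) u1 t1); rewrite /M; ring.
have w0 : b * c + 2 * M * k2 + M ^+ 2 * e = a * f.
  apply: (lincomb4 (c1 := -2) (c2 := 1) (c3 := 1) (c4 := M) u0 t0 z hk); ring.
split; split => /=.
(* The fourth line passes through P. When M = 0, the function q(x) only
   sees x-coordinates, and P = -R. *)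
- have [M0 | nM0] := eqVneq M 0.
    have ac : a = c by apply/eqP; rewrite -subr_eq0 u1' M0 mul0r.
    subst c; have yac : ya = - yc.
      apply/eqP; rewrite -addr_eq0; apply: contraNT nPR => ny.
      rewrite xpair_eqE eqxx /= -subr_eq0 -[_ == 0]orbF -(negPf ny) -mulf_eq0.
      by rewrite -subr_sqr (eqP oP) (eqP oR) subrr.
    by rewrite yac hR M0; ring.
  apply: (mulfI nM0).
  have va : M * ya = (a - b) * (a - c) + M * (m2 * a + k2).
    by apply: (lincomb3 (c1 := M) (c2 := a) (c3 := 1) hP u1 u0); ring.
  by apply: (lincomb3 (c1 := 1) (c2 := a) (c3 := 1) va w1 w0); ring.
- by rewrite hE; ring.
(* It passes through G; when M = 0, this point is -Q. *)
- have [M0 | nM0] := eqVneq M 0.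
    have fb : f = b by apply/esym/eqP; rewrite -subr_eq0 v M0 mul0r.
    have m31 : m3 = - m1 by apply/eqP; rewrite -addr_eq0 addrC; apply/eqP.
    move: hk; rewrite M0 oppr0 mul0r => /eqP.
    rewrite addrC addr_eq0 => /eqP k31.
    apply: (lincomb3 (c1 := 1) (c2 := 1) (c3 := -1) hG hQ hQ').
    by rewrite fb m31 k31; ring.
  apply: (mulfI nM0).
  have vf : M * yf = (f - b) * (f - c) + M * (m2 * f + k2).
    have tf : M * (m3 * f + k3) = (f - a) * (f - b) + M * (m1 * f + k1).
      by apply: (lincomb2 (c1 := -f) (c2 := -1) t1 t0); ring.
    apply: (lincomb4 (c1 := M) (c2 := 1) (c3 := f) (c4 := 1) hG tf u1 u0).
    by ring.
  by apply: (lincomb3 (c1 := 1) (c2 := f) (c3 := 1) vf w1 w0); ring.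
- apply: (lincomb3 (c1 := 1) (c2 := -2) (c3 := 1) q1 u1 t1).
  by rewrite /M; ring.
- by apply: (lincomb3 (c1 := 1) (c2 := -1) (c3 := e) q2 w0 w1); ring.
- by apply: (lincomb2 (c1 := 1) (c2 := -e) q3 w0); ring.
Qed.

(** When Q and R have the same x-coordinate, exchanging P and R reduces to the
    lemma above, unless P = Q = R; then commutativity suffices. *)
Lemma legendre_addA P Q R :
    on_legendre l P -> on_legendre l Q -> on_legendre l R ->
  P +% Q +% R = P +% (Q +% R).
Proof.
move=> oP oQ oR.
have [-> | P0] := eqVneq P None; first by [].
have [-> | Q0] := eqVneq Q None; first by rewrite legendre_addr0.
have [-> | R0] := eqVneq R None; first by rewrite !legendre_addr0.
have [QP | nQP] := eqVneq Q (legendre_opp P).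
  have oP' : on_legendre l (legendre_opp P) by rewrite on_legendre_opp.
  rewrite QP legendre_addrN legendre_add0r -{1}[P]legendre_oppK.
  by rewrite legendre_addKN.
have [RQ | nRQ] := eqVneq R (legendre_opp Q).
  have oQ' : on_legendre l (legendre_opp Q) by rewrite on_legendre_opp.
  rewrite RQ legendre_addrN legendre_addr0 legendre_addC ?on_legendre_add //.
  by rewrite [P +% Q]legendre_addC // legendre_addKN.
have [RS | nRS] := eqVneq R (legendre_opp (P +% Q)).
  rewrite RS legendre_addrN legendre_opp_add //.
  rewrite [legendre_opp P +% _]legendre_addC ?on_legendre_opp //.
  rewrite -{1}[Q]legendre_oppK legendre_addKN ?on_legendre_opp //.
  by rewrite legendre_addrN.
have [TP | nTP] := eqVneq (Q +% R) (legendre_opp P).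
  have eP : P = legendre_opp Q +% legendre_opp R.
    by rewrite -legendre_opp_add // TP legendre_oppK.
  rewrite TP legendre_addrN [P +% Q]legendre_addC // eP.
  rewrite -{1}[Q]legendre_oppK legendre_addKN ?on_legendre_opp //.
  by rewrite legendre_addC ?legendre_addrN // on_legendre_opp.
case eS: (P +% Q) => [S|]; last first.
  by case/eqP: nQP; rewrite -[RHS]legendre_addr0 -eS legendre_addKN.
case eT: (Q +% R) => [T|]; last first.
  by case/eqP: nRQ; rewrite -[RHS]legendre_addr0 -eT legendre_addKN.
case: P Q R P0 Q0 R0 oP oQ oR nQP nRQ nRS nTP eS eT
  => [P|] [Q|] [R|] // _ _ _ oP oQ oR nQP nRQ nRS nTP eS eT.
rewrite eS /= in nRS; rewrite eT /= in nTP.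
have nSR : S != neg R.
  by apply: contraNneq nRS => ->; rewrite /= negK.
have [QR1 | QR1] := eqVneq Q.1 R.1; last first.
  exact: (legendre_addA_chord oP oQ oR).
have [QP1 | QP1] := eqVneq Q.1 P.1; last first.
  have oS : on_legendre l (Some S) by rewrite -eS on_legendre_add.
  have oT : on_legendre l (Some T) by rewrite -eT on_legendre_add.
  rewrite legendre_addC // [RHS]legendre_addC //.
  apply/esym; apply: (legendre_addA_chord oR oQ oP) => //.
  - by rewrite legendre_addC.
  - by rewrite legendre_addC.
have same U V : on_legendre l (Some U) -> on_legendre l (Some V) ->
    Some V != legendre_opp (Some U) -> U.1 = V.1 -> U = V.
  case: U V => [x y] [x' y'] /= /eqP oU /eqP oV nVU ex; subst x'.
  apply/eqP; rewrite xpair_eqE eqxx /= -subr_eq0.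
  apply: contraNT nVU => ny; rewrite (inj_eq Some_inj) xpair_eqE eqxx /=.
  rewrite -addr_eq0 addrC -[_ == 0]orFb -(negPf ny) -mulf_eq0.
  by rewrite -subr_sqr oU oV subrr.
have eQR : Q = R by apply: same.
have ePQ : P = Q by apply: same.
have oS : on_legendre l (Some S) by rewrite -eS on_legendre_add.
by subst; move: eT; rewrite eS => -[<-]; rewrite legendre_addC.
Qed.

Local Notation mul := (legendre_mul l).

Lemma on_legendre_mul n P : on_legendre l P -> on_legendre l (mul n P).
Proof. by move=> oP; elim: n => //= n IHn; rewrite on_legendre_add. Qed.

Lemma legendre_mulD m n P :
  on_legendre l P -> mul (m + n) P = mul m P +% mul n P.
Proof.
move=> oP; elim: m => // m IHm.
rewrite addSn [LHS]/(P +% mul (m + n) P) IHm [mul m.+1 P]/(P +% mul m P).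
by rewrite legendre_addA ?on_legendre_mul.
Qed.

Lemma legendre_mul2 P : mul 2 P = P +% P.
Proof. by rewrite /legendre_mul /= legendre_addr0. Qed.

Lemma legendre_mulM m n P :
  on_legendre l P -> mul (m * n) P = mul m (mul n P).
Proof.
by move=> oP; elim: m => // m IHm; rewrite mulSn legendre_mulD // IHm.
Qed.

Lemma legendre_mul0 n : mul n None = None.
Proof. by elim: n. Qed.

Lemma legendre_mul_mod N n P : on_legendre l P -> mul N P = None ->
  mul (n %% N) P = mul n P.
Proof.
move=> oP hN; rewrite [in RHS](divn_eq n N) legendre_mulD // legendre_mulM //.
by rewrite hN legendre_mul0.
Qed.

End GroupLaw.

(** * Torsion points and duplication *)

Section Torsion.
Variables (F : fieldType) (l : F).
Hypotheses (two_neq0 : 2 != 0 :> F) (l_neq0 : l != 0) (l_neq1 : l != 1).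
Local Notation point := (legendre_point F).
Local Notation "P +% Q" :=
  (legendre_add l P Q) (at level 50, left associativity).
Local Notation mul := (legendre_mul l).

Definition dbl (x : F) : F := (x ^+ 2 - l) ^+ 2 / (4 * x * (x - 1) * (x - l)).

Definition torsion_x (x : F) : Prop :=
  exists y : F, on_legendre l (Some (x, y)) /\ legendre_torsion l (Some (x, y)).

(** The x-coordinates of the points of order 2, where duplication leaves the
    affine plane. *)
Definition branch_x (x : F) : bool := [|| x == 0, x == 1 | x == l].

Lemma legendre_add_self x y : on_legendre l (Some (x, y)) -> ~~ branch_x x ->
  exists z, Some (x, y) +% Some (x, y) = Some (dbl x, z).
Proof.
move=> /eqP oP; rewrite !negb_or -![x == 1]subr_eq0 -![x == l]subr_eq0.
move=> /and3P[x0 x1 xl].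
have four_neq0 : 4 != 0 :> F by rewrite (_ : 4 = 2 * 2) ?mulf_neq0 //; ring.
have y2 : y ^+ 2 != 0 by rewrite oP !mulf_neq0.
have y0 : y *+ 2 != 0.
  rewrite -mulr_natl mulf_neq0 //.
  by apply: contraNneq y2 => ->; rewrite expr0n.
rewrite /= eqxx -addr_eq0 -mulr2n (negPf y0) /=; eexists; congr (Some (_, _)).
rewrite expr_div_n (_ : (y *+ 2) ^+ 2 = 4 * (x * (x - 1) * (x - l))).
  by rewrite /dbl; field; rewrite four_neq0 x0 x1 xl.
by rewrite -oP; ring.
Qed.

Lemma torsion_dbl x : torsion_x x -> ~~ branch_x x -> torsion_x (dbl x).
Proof.
move=> [y [oP [n n0 hn]]] /(legendre_add_self oP) [z hz].
exists z; rewrite -hz; split; first by rewrite on_legendre_add.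
exists n; first by [].
by rewrite -legendre_mul2 -legendre_mulM // mulnC legendre_mulM // hn.
Qed.

(** If NP = O, then 2^n P only depends on 2^n modulo N, hence two of these
    points agree. *)
Lemma torsion_dbl_cycle x : torsion_x x ->
    (forall n, ~~ branch_x (iter n dbl x)) ->
  exists i j, (i < j)%N /\ iter i dbl x = iter j dbl x.
Proof.
move=> [y [oP [[//|N] _ hN]]] nb; set P := Some (x, y) in oP hN.
have orb n : exists z, mul (2 ^ n) P = Some (iter n dbl x, z).
  elim: n => [|n [z hz]]; first by exists y; rewrite expn0.
  have oz : on_legendre l (Some (iter n dbl x, z)).
    by rewrite -hz on_legendre_mul.
  have [w hw] := legendre_add_self oz (nb n).
  by exists w; rewrite expnS legendre_mulM // hz legendre_mul2 hw.
pose f (k : 'I_N.+2) : 'I_N.+1 := inord (2 ^ k %% N.+1).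
have /injectivePn [i [j nij fij]] : ~~ injectiveb f.
  by apply/injectiveP => /leq_card; rewrite !card_ord ltnn.
have eij : iter i dbl x = iter j dbl x.
  have [zi hi] := orb i; have [zj hj] := orb j.
  move/(congr1 val): fij; rewrite /= !inordK ?ltn_mod // => e.
  move: hi; rewrite -(legendre_mul_mod _ _ _ _ _ hN) // e.
  by rewrite legendre_mul_mod // hj => -[].
case: (ltngtP i j) => [ij|ji|/val_inj eq_ij].
- by exists i, j.
- by exists j, i.
- by rewrite eq_ij eqxx in nij.
Qed.

End Torsion.

(** * Existence of valuation rings *)

Section Chevalley.
Variable K : fieldType.
Implicit Types (A O : set K) (t x u : K).

Definition subring A : Prop :=
  [/\ A 1, forall x y, A x -> A y -> A (x - y) &
      forall x y, A x -> A y -> A (x * y)].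

Section SubringTheory.
Variable A : set K.
Hypothesis rA : subring A.

Lemma subring1 : A 1. Proof. by case: rA. Qed.
Lemma subringB x y : A x -> A y -> A (x - y).
Proof. by case: rA => _ + _; apply. Qed.
Lemma subringM x y : A x -> A y -> A (x * y).
Proof. by case: rA => _ _; apply. Qed.
Lemma subring0 : A 0.
Proof. by rewrite -(subrr 1); apply: subringB subring1 subring1. Qed.
Lemma subringN x : A x -> A (- x).
Proof. by rewrite -[- x]add0r; apply: subringB subring0. Qed.
Lemma subringD x y : A x -> A y -> A (x + y).
Proof.
by move=> hx hy; rewrite -[y]opprK; apply: subringB hx (subringN hy).
Qed.
Lemma subringX x n : A x -> A (x ^+ n).
Proof.
move=> hx; elim: n => [|n IHn]; first exact: subring1.
by rewrite exprS; apply: subringM.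
Qed.
Lemma subring_sum n (f : nat -> K) :
  (forall i, A (f i)) -> A (\sum_(i < n) f i).
Proof.
by move=> hf; elim/big_ind: _ => //; [apply: subring0 | apply: subringD].
Qed.
Lemma subring_nat n : A n%:R.
Proof.
elim: n => [|n IHn]; first exact: subring0.
by rewrite -natr1; apply: subringD IHn subring1.
Qed.

Definition coef_in (p : {poly K}) : Prop := forall i, A p`_i.

Definition adjoin x : set K :=
  [set z | exists2 p : {poly K}, coef_in p & z = p.[x]].

Lemma sub_adjoin x : (A `<=` adjoin x)%classic.
Proof.
move=> a ha; exists a%:P; last by rewrite hornerC.
by move=> i; rewrite coefC; case: eqP => // _; apply: subring0.
Qed.

Lemma adjoin_gen x : adjoin x x.
Proof.
exists 'X; last by rewrite hornerX.
by move=> i; rewrite coefX; apply: subring_nat.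
Qed.

Lemma adjoin_subring x : subring (adjoin x).
Proof.
split; first exact/sub_adjoin/subring1.
- move=> _ _ [p hp ->] [q hq ->]; exists (p - q); last by rewrite !hornerE.
  by move=> i; rewrite coefB; apply: subringB.
- move=> _ _ [p hp ->] [q hq ->]; exists (p * q); last by rewrite hornerM.
  move=> i; rewrite coefM.
  by apply: (@subring_sum _ (fun j => p`_j * q`_(i - j))) => j; apply: subringM.
Qed.

End SubringTheory.

(** Containing A is only required of inhabited sets, so that the family to which
    Zorn's lemma is applied includes the union of the empty chain. *)
Lemma maximal_subring A t : subring A -> ~ A t^-1 ->
  exists O, [/\ subring O, (A `<=` O)%classic, ~ O t^-1 &
    forall B, subring B -> (O `<=` B)%classic -> ~ B t^-1 ->
      (B `<=` O)%classic].
Proof.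
move=> rA nA.
pose ok (B : set K) := [/\ forall x y, B x -> B y -> B (x - y),
  forall x y, B x -> B y -> B (x * y), ~ B t^-1 &
  forall x, B x -> (A `<=` B)%classic].
have okP B : subring B -> (A `<=` B)%classic -> ~ B t^-1 -> ok B.
  by case=> B1 B2 B3 AB nB; split.
have [|O [[OB OM Ot OA] Omax]] := @Zorn_bigcup K ok.
  move=> Fm okF tot.
  have two x y :
      (\bigcup_(X in Fm) X)%classic x -> (\bigcup_(X in Fm) X)%classic y ->
      exists2 X, Fm X & X x /\ X y.
    move=> [X FX Xx] [Y FY Yy]; case: (tot X Y FX FY) => sub.
      by exists Y => //; split=> //; apply: sub.
    by exists X => //; split=> //; apply: sub.
  split.
  - move=> x y hx hy; have [X FX [Xx Xy]] := two x y hx hy.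
    by exists X => //; case: (okF X FX) => h _ _ _; apply: h.
  - move=> x y hx hy; have [X FX [Xx Xy]] := two x y hx hy.
    by exists X => //; case: (okF X FX) => _ h _ _; apply: h.
  - by move=> [X FX]; case: (okF X FX).
  - move=> x [X FX Xx] a Aa; exists X => //.
    by case: (okF X FX) => _ _ _ /(_ x Xx); apply.
have O1 : O 1.
  apply: contrapT => nO1; apply: (Omax A); last by apply: okP.
  split; last by move=> /(_ 1 (subring1 rA)).
  by move=> x Ox; case: nO1; apply: (OA x Ox); apply: subring1.
have sAO : (A `<=` O)%classic by apply: (OA 1).
exists O; split=> // B rB sOB nB; apply: contrapT => nBO.
by apply: (Omax B) => //; apply: okP => // x /sAO/sOB.
Qed.

Section MaximalIsValuation.
Variables (O : set K) (t : K).
Hypotheses (rO : subring O) (tO : O t) (ntO : ~ O t^-1).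
Hypothesis maxO :
  forall B, subring B -> (O `<=` B)%classic -> ~ B t^-1 -> (B `<=` O)%classic.

Let t_neq0 : t != 0.
Proof.
by apply: contra_notN ntO => /eqP ->; rewrite invr0; apply: subring0.
Qed.

Lemma not_unit_adjoin x : ~ O x -> adjoin O x t^-1.
Proof.
move=> nx; apply: contrapT => nt; apply: nx.
apply: (maxO (adjoin_subring rO x)) => //; first exact: sub_adjoin.
exact: adjoin_gen.
Qed.

(** In other words, t lies in the Jacobson radical of O. With u = 1 + ta, if
    u^-1 were not in O, then t^-1 would be a polynomial in u^-1, hence some
    power of u would be a multiple of t in O; but it is also congruent to 1
    modulo t, and t is not invertible. *)
Lemma one_plus_unit a : O a -> 1 + t * a != 0 /\ O (1 + t * a)^-1.
Proof.
move=> Oa; set u := 1 + t * a.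
have Ou : O u by apply: subringD (subring1 rO) (subringM _ _ _).
have u0 : u != 0.
  apply: contra_notN ntO => /eqP u0.
  suff -> : t^-1 = - a by apply: subringN.
  apply: (mulfI t_neq0); rewrite mulfV // mulrN; apply/eqP.
  by rewrite -addr_eq0 -/u u0.
split=> //; apply: contrapT => /not_unit_adjoin[p hp ep].
have [b Ob eb] : exists2 b, O b & u ^+ size p = t * b.
  exists (\sum_(i < size p) p`_i * u ^+ (size p - i)).
    apply: (@subring_sum _ rO _ (fun i => p`_i * u ^+ (size p - i))) => i.
    by apply: (subringM rO); [apply: hp | apply: (subringX rO)].
  rewrite -[LHS](mulVKf t_neq0); congr (t * _).
  rewrite ep horner_coef mulr_suml; apply: eq_bigr => i _.
  rewrite -mulrA; congr (_ * _).
  by rewrite exprVn mulrC -expfB_cond // (negPf u0) add0n ltnW.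
have [c Oc ec] : exists2 c, O c & u ^+ size p = 1 + t * c.
  elim: (size p) => [|n [c Oc ec]].
    by exists 0; rewrite ?mulr0 ?addr0 //; apply: subring0.
  exists (c + a * u ^+ n); last by rewrite exprS {1}/u mulrDl mul1r {1}ec; ring.
  by apply: subringD => //; apply: subringM => //; apply: subringX.
apply: ntO; suff -> : t^-1 = b - c by apply: subringB.
apply: (mulfI t_neq0); rewrite mulfV // mulrBr -eb ec; ring.
Qed.

(** A relation of degree at most n in x, which shows that t generates the unit
    ideal of O[x]. *)
Definition unit_witness x n := exists p : {poly K},
  [/\ coef_in O p, (size p <= n.+1)%N & t * p.[x] = 1].

(** Since 1 - t q_0 is a unit, the relation for x^-1 expresses x^m through lower
    powers of x; substituting this in the term of degree n of the relation for x
    lowers its degree. *)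
Lemma unit_witness_drop x n m :
    x != 0 -> (m <= n)%N -> unit_witness x n -> unit_witness x^-1 m ->
  (0 < n)%N /\ unit_witness x n.-1.
Proof.
move=> x0 le_mn [p [pO ps pt]] [q [qO qs qt]].
have [u0 Ou] := one_plus_unit (subringN rO (qO 0)).
set u := 1 + _ in u0 Ou; pose r := \poly_(i < m) q`_(m - i).
have ur : u * x ^+ m = t * r.[x].
  rewrite /u mulrDl -{1}qt (horner_coef_wide _ qs) big_ord_recl expr0 mulr1.
  rewrite horner_poly [in RHS](reindex_inj rev_ord_inj) /=.
  rewrite !mulrDr mulrDl mulrN mulNr addrAC subrr add0r -mulrA; congr (t * _).
  rewrite mulr_suml; apply: eq_bigr => i _.
  rewrite (_ : bump 0 i = (m - (m - i.+1))%N).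
    rewrite -mulrA; congr (_ * _).
    rewrite exprVn mulrC -expfB_cond ?(negPf x0) ?add0n ?leq_subr //.
    by rewrite subKn ?leq_subr.
  by rewrite /bump leq0n add1n subKn.
have m0 : (0 < m)%N.
  rewrite lt0n; apply: contraNneq u0 => m0; move: ur.
  by rewrite horner_poly m0 mulr1 big_ord0 mulr0 => ->.
split; first exact: leq_trans le_mn.
have rs : (size r <= m)%N by apply: size_poly.
have rOc : coef_in O r.
  by move=> i; rewrite coef_poly; case: ifP => // _; apply: subring0.
pose s := \poly_(i < n) p`_i + (p`_n * (t * u^-1)) *: ('X^(n - m) * r).
have n0 := leq_trans m0 le_mn.
exists s; rewrite prednK //; split.
- move=> i; rewrite coefD coefZ coefXnM coef_poly; apply: (subringD rO).
    by case: ifP => // _; apply: subring0.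
  apply: (subringM rO).
    by apply: (subringM rO (pO n)); apply: (subringM rO).
  by case: ifP => _; [apply: subring0 | apply: rOc].
- rewrite (leq_trans (size_polyD _ _)) // geq_max size_poly.
  rewrite (leq_trans (size_scale_leq _ _)) //.
  rewrite (leq_trans (size_polyMleq _ _)) //.
  by rewrite size_polyXn addSn /= -[leqRHS](subnK le_mn) leq_add2l.
- rewrite -pt (horner_coef_wide _ ps) big_ord_recr /= hornerD horner_poly.
  congr (t * (_ + _)); rewrite hornerZ hornerM hornerXn -mulrA; congr (_ * _).
  rewrite mulrCA -[in RHS](subnK le_mn) exprD; congr (_ * _).
  by rewrite -[RHS](mulKf u0) ur; ring.
Qed.

(** If neither x nor x^-1 were in O, then t^-1 would lie in both O[x] and
    O[x^-1], which is impossible by descent on the degrees of the relations. *)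
Lemma maximal_valuation x : O x \/ O x^-1.
Proof.
apply: contrapT => /not_orP[nx nxV].
have x0 : x != 0 by apply: contra_notN nx => /eqP ->; apply: subring0.
have witness y : adjoin O y t^-1 -> exists n, unit_witness y n.
  by move=> [p hp e]; exists (size p), p; split=> //; rewrite -e mulfV.
have [n hn] := witness _ (not_unit_adjoin nx).
have [m hm] := witness _ (not_unit_adjoin nxV).
have [k] := ubnP (n + m).
elim: k n m x x0 {nx nxV} hn hm => // k IHk n m x x0 hn hm.
wlog le_mn : x n m x0 hn hm / (m <= n)%N.
  move=> wl; have [le|/ltnW le] := leqP m n; first exact: (wl x n m).
  by rewrite addnC; apply: (wl x^-1) => //; rewrite ?invr_eq0 ?invrK.
have [n0 hn'] := unit_witness_drop x0 le_mn hn hm.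
move=> lt; apply: (IHk n.-1 m x) => //; by case: n n0 lt {hn hn' le_mn}.
Qed.

End MaximalIsValuation.

Record valuation_ring := ValuationRing {
  integral :> K -> Prop;
  integral_subring : subring integral;
  integral_total : forall x, integral x \/ integral x^-1 }.

(** This is the case of Chevalley's extension theorem for the ideal generated
    by t. *)
Lemma valuation_ring_excluding A t : subring A -> A t -> ~ A t^-1 ->
  exists O : valuation_ring, ~ O t^-1.
Proof.
move=> rA At nA; have [O [rO sAO nO maxO]] := maximal_subring rA nA.
by exists (ValuationRing rO (maximal_valuation rO (sAO _ At) nO maxO)).
Qed.

End Chevalley.

(** * Divisibility with respect to a valuation ring *)

Section Valuation.
Variables (K : fieldType) (O : valuation_ring K).
Let rO := integral_subring O.
Let vO := integral_total O.
Implicit Types x y z w c : K.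

(** The preorder vle is |x| <= |y| for the absolute value defined by O. It
    avoids the value group of O, and it makes sense for x or y equal to 0. *)
Definition vle x y : Prop := exists2 c, O c & x = c * y.
Definition vlt x y : Prop := ~ vle y x.
Definition veq x y : Prop := vle x y /\ vle y x.

Local Notation "x <=v y" := (vle x y) (at level 70).
Local Notation "x <v y" := (vlt x y) (at level 70).
Local Notation "x =v y" := (veq x y) (at level 70).

Lemma vle_refl x : x <=v x.
Proof. by exists 1; rewrite ?mul1r //; apply: (subring1 rO). Qed.

Lemma vle_trans y x z : x <=v y -> y <=v z -> x <=v z.
Proof.
move=> [c Oc ->] [d Od ->]; exists (c * d); rewrite ?mulrA //.
exact: subringM.
Qed.

Lemma vle0 x : 0 <=v x.
Proof. by exists 0; rewrite ?mul0r //; apply: subring0. Qed.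

Lemma vlex0 x : x <=v 0 -> x = 0.
Proof. by case=> c _ ->; rewrite mulr0. Qed.

Lemma vle1 x : x <=v 1 <-> O x.
Proof.
by split=> [[c Oc ->]|Ox]; [rewrite mulr1 | exists x; rewrite ?mulr1].
Qed.

Lemma vle_total x y : x <=v y \/ y <=v x.
Proof.
have [->|y0] := eqVneq y 0; first by right; apply: vle0.
have [->|x0] := eqVneq x 0; first by left; apply: vle0.
case: (vO (x / y)) => h; [left|right]; eexists; try exact: h.
  by rewrite mulfVK.
by rewrite invf_div mulfVK.
Qed.

Lemma vltW x y : x <v y -> x <=v y.
Proof. by case: (vle_total x y). Qed.

Lemma vle_mul x y z w : x <=v y -> z <=v w -> x * z <=v y * w.
Proof.
move=> [c Oc ->] [d Od ->]; exists (c * d); first exact: subringM.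
by rewrite mulrACA.
Qed.

Lemma vle_mul2r z x y : z != 0 -> x * z <=v y * z -> x <=v y.
Proof.
by move=> z0 [c Oc e]; exists c => //; apply: (mulIf z0); rewrite e mulrA.
Qed.

Lemma vle_add x y z : x <=v z -> y <=v z -> x + y <=v z.
Proof.
move=> [c Oc ->] [d Od ->]; exists (c + d); last by rewrite mulrDl.
exact: subringD.
Qed.

Lemma vleN x : - x <=v x.
Proof.
by exists (-1); [exact: (subringN rO (subring1 rO)) | rewrite mulN1r].
Qed.

Lemma vle_vlt_trans y x z : x <=v y -> y <v z -> x <v z.
Proof. by move=> xy yz zx; apply: yz; apply: vle_trans xy. Qed.

Lemma vlt_vle_trans y x z : x <v y -> y <=v z -> x <v z.
Proof. by move=> xy yz zx; apply: xy; apply: vle_trans zx. Qed.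

Lemma vlt_trans y x z : x <v y -> y <v z -> x <v z.
Proof. by move=> xy /vltW; apply: vlt_vle_trans. Qed.

Lemma vltxx x : ~ x <v x.
Proof. by apply; apply: vle_refl. Qed.

Lemma vlt_neq0 x y : x <v y -> y != 0.
Proof. by move=> h; apply/eqP=> y0; apply: h; rewrite y0; apply: vle0. Qed.

Lemma vlt_add x y z : x <v z -> y <v z -> x + y <v z.
Proof.
move=> xz yz; case: (vle_total x y) => [xy|yx].
  by apply: vle_vlt_trans yz; apply: vle_add => //; apply: vle_refl.
by apply: vle_vlt_trans xz; apply: vle_add => //; apply: vle_refl.
Qed.

Lemma vlt_mul2r z x y : z != 0 -> x <v y -> x * z <v y * z.
Proof. by move=> z0 xy h; apply: xy; apply: vle_mul2r h. Qed.

Lemma veq_refl x : x =v x. Proof. by split; apply: vle_refl. Qed.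
Lemma veq_sym x y : x =v y -> y =v x. Proof. by case. Qed.
Lemma veq_trans y x z : x =v y -> y =v z -> x =v z.
Proof.
move=> [xy yx] [yz zy].
by split; [apply: vle_trans yz | apply: vle_trans yx].
Qed.

#[export] Instance veq_equiv : Equivalence veq.
Proof.
split=> [x|x y|x y z]; first exact: veq_refl.
  exact: veq_sym.
exact: veq_trans.
Qed.

#[export] Instance mul_veq : Proper (veq ==> veq ==> veq) (@GRing.mul K).
Proof. by move=> x y [xy yx] z w [zw wz]; split; apply: vle_mul. Qed.

#[export] Instance vle_veq : Proper (veq ==> veq ==> iff) vle.
Proof.
move=> x y [xy yx] z w [zw wz]; split=> h.
  exact: vle_trans yx (vle_trans h zw).
exact: vle_trans xy (vle_trans h wz).
Qed.

#[export] Instance vlt_veq : Proper (veq ==> veq ==> iff) vlt.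
Proof. by move=> x y xy z w zw; rewrite /vlt xy zw. Qed.

Lemma veq_opp x : - x =v x.
Proof. by split; [|rewrite -{1}[x]opprK]; apply: vleN. Qed.

#[export] Instance opp_veq : Proper (veq ==> veq) (@GRing.opp K).
Proof. by move=> x y xy; rewrite (veq_opp x) (veq_opp y). Qed.

#[export] Instance exp_veq : Proper (veq ==> eq ==> veq) (@GRing.exp K).
Proof.
move=> x y xy n _ <-; elim: n => [|n IHn]; first exact: veq_refl.
by rewrite !exprS; apply: mul_veq.
Qed.

(** The ultrametric inequality is an equality for terms of distinct sizes. *)
Lemma veq_addr x y : y <v x -> x + y =v x.
Proof.
move=> yx; split; first by apply: vle_add (vle_refl x) (vltW yx).
apply: contrapT => h; apply: (@vltxx x).
rewrite -{1}[x](addrK y); apply: vlt_add h _.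
by rewrite veq_opp.
Qed.

Lemma veq_subr x y : y <v x -> x - y =v x.
Proof. by move=> yx; apply: veq_addr; rewrite veq_opp. Qed.

Lemma vle_sub x y z : x <=v z -> y <=v z -> x - y <=v z.
Proof. by move=> xz yz; apply: vle_add => //; rewrite veq_opp. Qed.

Lemma vlt_sub x y z : x <v z -> y <v z -> x - y <v z.
Proof. by move=> xz yz; apply: vlt_add => //; rewrite veq_opp. Qed.

Lemma veq_mul2r z x y : z != 0 -> x * z =v y * z -> x =v y.
Proof. by move=> z0 [h1 h2]; split; apply: (vle_mul2r z0). Qed.

Lemma vle_sqr x y : x ^+ 2 <=v y ^+ 2 -> x <=v y.
Proof.
move=> h; apply: contrapT => xy; have x0 := vlt_neq0 xy.
have y1 : y * y <=v x * y by apply: vle_mul (vltW xy) (vle_refl y).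
have y2 : y * x <v x * x by apply: vlt_mul2r.
by apply: y2; rewrite -expr2 [y * x]mulrC; apply: vle_trans h _; rewrite expr2.
Qed.

End Valuation.

(** * Torsion points at a place above 2 *)

Section Dyadic.
Variables (K : fieldType) (O : valuation_ring K).
Hypothesis nhalf : ~ O 2^-1.
Local Notation vle := (vle O).
Local Notation vlt := (vlt O).
Local Notation veq := (veq O).
Local Notation "x <=v y" := (vle x y) (at level 70).
Local Notation "x <v y" := (vlt x y) (at level 70).
Local Notation "x =v y" := (veq x y) (at level 70).

Lemma two_neq0 : 2 != 0 :> K.
Proof.
apply: contra_notN nhalf => /eqP ->; rewrite invr0.
exact: (subring0 (integral_subring O)).
Qed.

Lemma lt2 : 2 <v 1.
Proof.
move=> [c Oc e]; apply: nhalf; suff -> : 2^-1 = c by [].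
by apply: (mulIf two_neq0); rewrite -e mulVf ?two_neq0.
Qed.

Lemma vlt_mull c x : c <v 1 -> x != 0 -> c * x <v x.
Proof. by move=> c1 x0; rewrite -[X in _ <v X]mul1r; apply: vlt_mul2r. Qed.

Lemma vle_mull c x : c <=v 1 -> c * x <=v x.
Proof.
move=> c1; rewrite -[X in _ <=v X]mul1r; apply: vle_mul => //.
exact: vle_refl.
Qed.

Lemma lt4 : 4 <v 1.
Proof.
rewrite (_ : 4 = 2 * 2); last by ring.
exact: (vlt_trans (vlt_mull lt2 two_neq0) lt2).
Qed.

Lemma four_neq0 : 4 != 0 :> K.
Proof. by rewrite (_ : 4 = 2 * 2) ?mulf_neq0 ?two_neq0 //; ring. Qed.

Lemma near1 x : x - 1 <v 1 -> x =v 1.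
Proof. by move=> h; rewrite -[x](subrK 1) addrC; apply: veq_addr. Qed.

(** If |u| and |w| differ, then |u + w| is the larger one, and the hypothesis
    says that it is |4| times the other one. So |u| = |w|, which turns the
    hypothesis into |u + w|^2 = |2w|^2. *)
Lemma veq_scale_sqr (u w : K) :
  w != 0 -> (u + w) ^+ 2 =v 4 * u * w -> u + w =v 2 * w.
Proof.
move=> w0 h.
have [uw|wu] : u =v w \/ ~ (u =v w) by apply: EM.
  have {}h : (u + w) ^+ 2 =v (2 * w) ^+ 2.
    rewrite h uw; rewrite (_ : 4 * w * w = (2 * w) ^+ 2); last by ring.
    reflexivity.
  by case: h => h1 h2; split; apply: vle_sqr.
case: (EM (u <v w)) => [lt|nlt].
  case: (@vltxx _ O w); apply: (vle_vlt_trans (y := u)) => //.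
  apply: (vle_mul2r w0); rewrite -expr2.
  have e : u + w =v w by rewrite addrC; apply: veq_addr.
  rewrite -{1}e h -mulrA; apply: vle_mull; exact: vltW lt4.
have lt : w <v u by move=> le; apply: wu; split=> //; apply: contrapT.
case: (@vltxx _ O u); apply: (vle_vlt_trans (y := w)) => //.
have u0 := vlt_neq0 lt.
apply: (vle_mul2r u0); rewrite -expr2.
have e : u + w =v u by apply: veq_addr.
rewrite -{1}e h (_ : 4 * u * w = 4 * (w * u)); last by ring.
by apply: vle_mull; exact: vltW lt4.
Qed.

Section Curve.
Variable l : K.
Hypotheses (l_neq0 : l != 0) (l_neq1 : l != 1).
Local Notation dbl := (dbl l).
Local Notation branch_x := (branch_x l).
Local Notation torsion_x := (torsion_x l).

Lemma dbl_denom_neq0 x : ~~ branch_x x -> 4 * x * (x - 1) * (x - l) != 0.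
Proof.
rewrite !negb_or -![x == 1]subr_eq0 -![x == l]subr_eq0 => /and3P[x0 x1 xl].
by rewrite !mulf_neq0 // four_neq0.
Qed.

(** For a point T of order 2, the four points P with 2P = T form two pairs of
    opposite points, so that dbl x takes each of the values 0, 1 and l doubly:
    dbl x, dbl x - 1 and dbl x - l are squares over the same denominator. *)
Lemma dbl0E x : ~~ branch_x x ->
  dbl x * (4 * x * (x - 1) * (x - l)) = (x ^+ 2 - l) ^+ 2.
Proof. by move=> /dbl_denom_neq0 h; rewrite /dbl mulfVK. Qed.

Lemma dbl1E x : ~~ branch_x x ->
  (dbl x - 1) * (4 * x * (x - 1) * (x - l)) = (x ^+ 2 - 2 * x + l) ^+ 2.
Proof. by move=> /dbl0E h; rewrite mulrBl h; ring. Qed.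

Lemma dbllE x : ~~ branch_x x ->
  (dbl x - l) * (4 * x * (x - 1) * (x - l)) = (x ^+ 2 - 2 * x * l + l) ^+ 2.
Proof. by move=> /dbl0E h; rewrite mulrBl h; ring. Qed.

Lemma dbl_escape x : 1 <v x -> l <v x -> ~~ branch_x x /\ x <v dbl x.
Proof.
move=> x1 xl; have x0 := vlt_neq0 x1.
have nb : ~~ branch_x x.
  rewrite !negb_or x0 /=; apply/andP; split; apply/eqP => e.
    by apply: (@vltxx _ O x); rewrite {1}e.
  by apply: (@vltxx _ O x); rewrite {1}e.
split=> //.
have e1 : x - 1 =v x by apply: veq_subr.
have el : x - l =v x by apply: veq_subr.
have eq : x ^+ 2 - l =v x ^+ 2.
  apply: veq_subr => //; apply: (vlt_trans xl).
  by rewrite -{1}[x]mul1r expr2; apply: vlt_mul2r.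
have : dbl x * (4 * x * (x - 1) * (x - l)) =v (x ^+ 2 - l) ^+ 2.
  by rewrite dbl0E //; reflexivity.
rewrite e1 el eq => h.
have {}h : 4 * dbl x =v x.
  apply: (veq_mul2r (z := x ^+ 3)); first by rewrite expf_neq0.
  rewrite (_ : 4 * dbl x * x ^+ 3 = dbl x * (4 * x * x * x)); last by ring.
  by rewrite h (_ : (x ^+ 2) ^+ 2 = x * x ^+ 3); [reflexivity | ring].
rewrite -{1}h; apply: vlt_mull; first exact: lt4.
apply: contraNneq x0 => d0; apply/eqP/(vlex0 (O := O)).
by rewrite d0 mulr0 in h; case: h.
Qed.

(** Duplication strictly increases the size of a point beyond this bound, so
    its iterates could not form a cycle. *)
Lemma torsion_x_bounded x : torsion_x x -> x <=v 1 \/ x <=v l.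
Proof.
move=> tx; apply: contrapT => /not_orP[x1 xl].
have orb n : 1 <v iter n dbl x /\ l <v iter n dbl x.
  elim: n => //= n [h1 hl]; have [_ lt] := dbl_escape h1 hl.
  by split; apply: (vlt_trans _ lt).
have step n : iter n dbl x <v iter n.+1 dbl x.
  by have [h1 hl] := orb n; have [] := dbl_escape h1 hl.
have [|i [j [ij eij]]] := torsion_dbl_cycle two_neq0 l_neq0 l_neq1 tx.
  by move=> n; have [h1 hl] := orb n; have [] := dbl_escape h1 hl.
apply: (@vltxx _ O (iter i dbl x)); rewrite {2}eij {eij}.
elim: j ij => // j IHj; rewrite ltnS leq_eqVlt => /orP[/eqP ->|/IHj h].
  exact: step.
exact: (vlt_trans h).
Qed.

Lemma dbl_bound a : torsion_x a -> ~~ branch_x a ->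
  (dbl a <=v 1 \/ dbl a <=v l) /\ torsion_x (dbl a).
Proof.
move=> ta nb; have td := torsion_dbl two_neq0 l_neq0 l_neq1 ta nb.
by split=> //; apply: torsion_x_bounded.
Qed.

Lemma branch_xN a : a != 0 -> a != 1 -> l != a -> ~~ branch_x a.
Proof. by move=> a0 a1 la; rewrite !negb_or a0 a1 eq_sym la. Qed.

Lemma torsion_bound_int a : l <=v 1 -> torsion_x a -> ~~ branch_x a ->
  dbl a <=v 1 /\ (a ^+ 2 - l) ^+ 2 <=v 4 * a * (a - 1) * (a - l).
Proof.
move=> l_int ta nb; have [bd _] := dbl_bound ta nb.
have {}bd : dbl a <=v 1 by case: bd => // bd; apply: vle_trans bd l_int.
by split=> //; rewrite -dbl0E //; apply: vle_mull.
Qed.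

Lemma torsion_bound_pole a : 1 <v l -> torsion_x a -> ~~ branch_x a ->
  dbl a <=v l /\ (a ^+ 2 - l) ^+ 2 <=v l * (4 * a * (a - 1) * (a - l)).
Proof.
move=> /vltW l_pole ta nb; have [bd _] := dbl_bound ta nb.
have {}bd : dbl a <=v l by case: bd => // bd; apply: vle_trans bd l_pole.
by split=> //; rewrite -dbl0E //; apply: vle_mul => //; apply: vle_refl.
Qed.

(** The bound for the x-coordinate of 2P reads
      |a^2 - l|^2 <= |4 a (a-1) (a-l)| max(1, |l|).
    If |l| > 1, then the left hand side is |l|^2 and the right hand side at most
    |4| |l|^2; otherwise the right hand side is at most |4|. *)
Lemma torsion_integral a : torsion_x a -> a != 0 -> a != 1 -> a <=v 1 ->
  l = a \/ l <=v 1 /\ a ^+ 2 - l <v 1.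
Proof.
move=> ta a0 a1 a_int; have [->|la] := eqVneq l a; [by left|right].
have nb := branch_xN a0 a1 la.
have a1_int : a - 1 <=v 1 by apply: vle_sub => //; apply: vle_refl.
have h4 := vle_refl O 4; have hl := vle_refl O l.
have [l_int|nl] := EM (l <=v 1).
  have al_int : a - l <=v 1 by apply: vle_sub.
  split=> // h; have [_ bd] := torsion_bound_int l_int ta nb.
  have : (a ^+ 2 - l) ^+ 2 <=v 4 * 1 * 1 * 1.
    apply: vle_trans bd _; apply: vle_mul => //.
    by apply: vle_mul => //; apply: vle_mul.
  rewrite !mulr1 => h1; apply: lt4; apply: vle_trans h1.
  by rewrite -[1](expr1n _ 2) !expr2; apply: vle_mul.
exfalso; have {}nl : 1 <v l := nl.
have [_ bd] := torsion_bound_pole nl ta nb.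
have eal : a - l =v l.
  rewrite -opprB veq_opp //; apply: veq_subr => //.
  exact: vle_vlt_trans a_int nl.
have ea2 : a ^+ 2 - l =v l.
  rewrite -opprB veq_opp //; apply: veq_subr => //.
  apply: vle_vlt_trans nl => //.
  by rewrite expr2 -[X in _ <=v X]mulr1; apply: vle_mul.
move: bd; rewrite ea2 eal => bd.
have : l ^+ 2 <=v l * (4 * 1 * 1 * l).
  apply: vle_trans bd _; apply: vle_mul => //; apply: vle_mul => //.
  by apply: vle_mul => //; apply: vle_mul.
rewrite (_ : l * (4 * 1 * 1 * l) = 4 * l ^+ 2); last by ring.
by apply: (vlt_mull lt4); rewrite expf_neq0.
Qed.

(** Reduction to 1 passes from a to l, because l is close to a^2. *)
Lemma torsion_odd a : torsion_x a -> a != 0 -> a != 1 -> a - 1 <v 1 ->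
  l - 1 <v 1.
Proof.
move=> ta a0 a1 aodd; have ea := near1 aodd.
have a_int : a <=v 1 by rewrite ea; apply: vle_refl.
have [->//|[l_int h]] := torsion_integral ta a0 a1 a_int.
rewrite (_ : l - 1 = (a + 1) * (a - 1) - (a ^+ 2 - l)); last by ring.
apply: vlt_sub => //; apply: vle_vlt_trans aodd => //; apply: vle_mull.
by apply: vle_add => //; apply: vle_refl.
Qed.

Lemma torsion_even a : torsion_x a -> a != 0 -> a <v 1 -> l <v 1.
Proof.
move=> ta a0 alt; have a1 : a != 1.
  by apply: contra_notN (@vltxx _ O 1) => /eqP a1; rewrite {1}a1 in alt.
have [->//|[l_int h]] := torsion_integral ta a0 a1 (vltW alt).
rewrite (_ : l = a * a - (a ^+ 2 - l)); last by ring.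
apply: vlt_sub => //.
exact: (vle_vlt_trans (vle_mull a (vltW alt)) alt).
Qed.

Lemma torsion_pole a : torsion_x a -> 1 <v a -> 1 <v l /\ a <=v l.
Proof.
move=> ta alt; have [//|al] := torsion_x_bounded ta.
by split=> //; apply: vlt_vle_trans alt al.
Qed.

(** With x = dbl a, suppose that 0 < |x| < 1. Then |dbl x| = 1 / |4x| > 1
    violates the bound for the point 4P. So |x| = 1, unless x = 0, which means
    l = a^2; and x = dbl a becomes |a^2 - l|^2 = |4 (a-l) (a-1)|, to which
    [veq_scale_sqr] applies. *)
Lemma torsion_odd_sharp a : torsion_x a -> a != 0 -> a != 1 -> a - 1 <v 1 ->
  [\/ l = a, l = a ^+ 2 | l - a ^+ 2 =v 2 * (a - 1)].
Proof.
move=> ta a0 a1 aodd; have ea := near1 aodd.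
have el := near1 (torsion_odd ta a0 a1 aodd).
have [->|la] := eqVneq l a; first by constructor 1.
have [la2|la2] := eqVneq l (a ^+ 2); [by constructor 2 | constructor 3].
have nb := branch_xN a0 a1 la.
have l_int : l <=v 1 by rewrite el; apply: vle_refl.
have [x_int _] := torsion_bound_int l_int ta nb; have [_ tx] := dbl_bound ta nb.
have eqx := dbl0E nb; move: (dbl a) x_int tx eqx => x x_int tx eqx.
have x0 : x != 0.
  apply: contraNneq la2 => x0; move/esym/eqP: eqx.
  by rewrite x0 mul0r expf_eq0 /= subr_eq0 eq_sym.
have ex : x =v 1.
  split=> //; apply: contrapT => x1; have {}x1 : x <v 1 := x1.
  have xl : x <v l by rewrite el.
  have x2l : x ^+ 2 <v l.
    by apply: vle_vlt_trans xl; rewrite expr2; apply: vle_mull.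
  have nbx : ~~ branch_x x.
    apply: branch_xN => //; apply/eqP => e.
      by apply: (@vltxx _ O 1); rewrite -{1}e.
    by apply: (@vltxx _ O x); rewrite -{2}e.
  have [_] := torsion_bound_int l_int tx nbx.
  have e1 : x - 1 =v 1 by rewrite -opprB veq_opp; apply: veq_subr.
  have exl : x - l =v 1.
    by rewrite -opprB veq_opp -[X in _ =v X]el; apply: veq_subr.
  have ex2 : x ^+ 2 - l =v 1.
    by rewrite -opprB veq_opp -[X in _ =v X]el; apply: veq_subr.
  rewrite e1 exl ex2 expr1n !mulr1; apply: vlt_trans x1.
  by apply: vlt_mull => //; apply: lt4.
have aw : a ^+ 2 - a =v a - 1.
  rewrite (_ : a ^+ 2 - a = a * (a - 1)); last by ring.
  by rewrite -[X in _ =v X]mul1r; apply: mul_veq => //; reflexivity.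
rewrite -opprB veq_opp -aw.
rewrite (_ : a ^+ 2 - l = (a - l) + (a ^+ 2 - a)); last by ring.
apply: veq_scale_sqr.
  by rewrite expr2 -{3}[a]mulr1 -mulrBr mulf_neq0 // subr_eq0.
rewrite (_ : (a - l) + (a ^+ 2 - a) = a ^+ 2 - l); last by ring.
rewrite -eqx ex aw {1}ea.
rewrite (_ : 1 * (4 * 1 * (a - 1) * (a - l)) = 4 * (a - l) * (a - 1)).
  reflexivity.
by ring.
Qed.

(** The same with x - 1 in place of x: the point 4P excludes 0 < |x - 1| < 1,
    and x = 1 means l = a(2-a). *)
Lemma torsion_even_sharp a : torsion_x a -> a != 0 -> a <v 1 ->
  [\/ l = a, l = a * (2 - a) | l - a * (2 - a) =v 2 * a].
Proof.
move=> ta a0 alt; have l_lt := torsion_even ta a0 alt.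
have a1 : a != 1 by apply/eqP => e; apply: (@vltxx _ O 1); rewrite -{1}e.
have [->|la] := eqVneq l a; first by constructor 1.
have [la2|la2] := eqVneq l (a * (2 - a)); [by constructor 2 | constructor 3].
have nb := branch_xN a0 a1 la; have l_int := vltW l_lt.
have [x_int _] := torsion_bound_int l_int ta nb; have [_ tx] := dbl_bound ta nb.
have eqx := dbl1E nb; move: (dbl a) x_int tx eqx => x x_int tx eqx.
have x1 : x != 1.
  apply: contraNneq la2 => x1; move/esym/eqP: eqx.
  rewrite x1 subrr mul0r expf_eq0 /= -[l == _]subr_eq0 => /eqP e.
  by apply/eqP; rewrite -[RHS]e; ring.
have ex : x - 1 =v 1.
  split; first by apply: vle_sub => //; apply: vle_refl.
  apply: contrapT => h; have {}h : x - 1 <v 1 := h; have e1 := near1 h.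
  have exl : x - l =v 1 by rewrite -e1; apply: veq_subr; rewrite e1.
  have ex2 : x ^+ 2 - l =v 1.
    rewrite -[X in _ =v X](expr1n _ 2) -e1; apply: veq_subr.
    by rewrite e1 expr1n.
  have nbx : ~~ branch_x x.
    apply: branch_xN => //; apply/eqP => e.
      by case: e1 => _; rewrite e => /vlex0/eqP; rewrite oner_eq0.
    by apply: (@vltxx _ O 1); rewrite -{1}e1 -e.
  have [_] := torsion_bound_int l_int tx nbx.
  rewrite exl ex2 {1}e1 expr1n !mulr1; apply: vlt_trans h.
  by apply: vlt_mull; rewrite ?subr_eq0 //; apply: lt4.
have e1 : a - 1 =v 1 by rewrite -opprB veq_opp; apply: veq_subr.
have aw : a ^+ 2 - a =v a.
  by rewrite expr2 -{3}[a]mulr1 -mulrBr e1 mulr1; reflexivity.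
rewrite -[X in _ =v _ * X]aw.
rewrite (_ : l - a * (2 - a) = (l - a) + (a ^+ 2 - a)); last by ring.
apply: veq_scale_sqr.
  by rewrite expr2 -{3}[a]mulr1 -mulrBr mulf_neq0 // subr_eq0.
rewrite (_ : (l - a) + (a ^+ 2 - a) = a ^+ 2 - 2 * a + l); last by ring.
rewrite -eqx ex aw e1 -[l - a]opprB (veq_opp O (a - l)).
rewrite (_ : 1 * (4 * a * 1 * (a - l)) = 4 * (a - l) * a); last by ring.
reflexivity.
Qed.

(** The same with x - l in place of x: the point 4P excludes 0 < |x - l| < |l|,
    and x = l means l(2a-1) = a^2. *)
Lemma torsion_pole_sharp a : torsion_x a -> 1 <v a ->
  [\/ l = a, l * (2 * a - 1) = a ^+ 2 |
      l * (2 * a - 1) - a ^+ 2 =v 2 * (l * a)].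
Proof.
move=> ta apole; have [l_pole al] := torsion_pole ta apole.
have a0 := vlt_neq0 apole.
have a1 : a != 1 by apply/eqP => e; apply: (@vltxx _ O 1); rewrite -{2}e.
have [->|la] := eqVneq l a; first by constructor 1.
have [la2|la2] := eqVneq (l * (2 * a - 1)) (a ^+ 2); first by constructor 2.
constructor 3.
have nb := branch_xN a0 a1 la.
have [x_le _] := torsion_bound_pole l_pole ta nb.
have [_ tx] := dbl_bound ta nb.
have eqx := dbllE nb; move: (dbl a) x_le tx eqx => x x_le tx eqx.
have xl : x != l.
  apply: contraNneq la2 => xl; move/esym/eqP: eqx.
  rewrite xl subrr mul0r expf_eq0 /= -[_ == a ^+ 2]subr_eq0 => /eqP e.
  by rewrite -oppr_eq0 -[X in _ == X]e; apply/eqP; ring.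
have ex : x - l =v l.
  split; first by apply: vle_sub => //; apply: vle_refl.
  apply: contrapT => h; have {}h : x - l <v l := h.
  have exl : x =v l by rewrite -[x](subrK l) addrC; apply: veq_addr.
  have e1 : x - 1 =v l by rewrite -exl; apply: veq_subr; rewrite exl.
  have ex2 : x ^+ 2 - l =v l ^+ 2.
    have e2 : x ^+ 2 =v l ^+ 2 by rewrite exl; reflexivity.
    rewrite -e2; apply: veq_subr; rewrite e2.
    by rewrite -{1}[l]mul1r expr2; apply: vlt_mul2r.
  have nbx : ~~ branch_x x.
    apply: branch_xN; last by rewrite eq_sym.
    - by apply/eqP => e; case: exl => _; rewrite e => /vlex0; apply/eqP.
    - by apply/eqP => e; apply: (@vltxx _ O 1); rewrite -{2}e exl.
  have [_] := torsion_bound_pole l_pole tx nbx.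
  rewrite e1 ex2 {1}exl.
  have -> : l * (4 * l * l * (x - l)) = (4 * (x - l)) * l ^+ 3 by ring.
  rewrite (_ : (l ^+ 2) ^+ 2 = l * l ^+ 3); last by ring.
  apply: vlt_mul2r; first by rewrite expf_neq0.
  by apply: vlt_trans h; apply: vlt_mull; rewrite ?subr_eq0 //; apply: lt4.
have e1 : 1 - a =v a by rewrite -opprB veq_opp; apply: veq_subr.
have aw : l * (1 - a) =v l * a by rewrite e1; reflexivity.
rewrite -[l * _ - _]opprB veq_opp -aw.
have -> : a ^+ 2 - l * (2 * a - 1) = a * (a - l) + l * (1 - a) by ring.
apply: veq_scale_sqr; first by rewrite mulf_neq0 // subr_eq0 eq_sym.
have -> : a * (a - l) + l * (1 - a) = a ^+ 2 - 2 * a * l + l by ring.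
rewrite -eqx ex aw -[a - 1]opprB (veq_opp O (1 - a)) e1.
have -> : l * (4 * a * a * (a - l)) = 4 * (a * (a - l)) * (l * a) by ring.
reflexivity.
Qed.

End Curve.
End Dyadic.

(** * Rational numbers at a place above 2 *)

(** One half is not in the image of the integers, hence is not in some valuation
    ring: a place above 2. *)
Lemma dyadic_valuation_ring (K : numFieldType) :
  exists O : valuation_ring K, ~ O 2^-1.
Proof.
apply: (@valuation_ring_excluding K [set x | exists z : int, x = z%:~R] 2).
- split; first by exists 1.
  + by move=> _ _ [z ->] [w ->]; exists (z - w); rewrite intrB.
  + by move=> _ _ [z ->] [w ->]; exists (z * w); rewrite intrM.
- by exists 2.
- move=> [z /(congr1 ( *%R 2))]; rewrite mulfV ?pnatr_eq0 // => e.
  have /intr_inj : 1%:~R = (2 * z)%:~R :> K by rewrite intrM -e.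
  by lia.
Qed.

Section DyadicRationals.
Variables (K : numFieldType) (O : valuation_ring K).
Hypothesis nhalf : ~ O 2^-1.
Local Notation "x <=v y" := (vle O x y) (at level 70).
Local Notation "x <v y" := (vlt O x y) (at level 70).
Local Notation "x =v y" := (veq O x y) (at level 70).
Implicit Types (a b : rat) (z : int).

Lemma nat_integral n : n%:R <=v 1.
Proof. exact/vle1/(subring_nat (integral_subring O)). Qed.

Lemma int_integral z : z%:~R <=v 1.
Proof.
case: z => n; last first.
  by rewrite NegzE intrN veq_opp; apply: nat_integral.
exact: nat_integral.
Qed.

Lemma int_even z : ~~ odd `|z| -> z%:~R <=v 2.
Proof.
move=> ev; have -> : z = 2 * (z %/ 2)%Z by lia.
rewrite intrM -[X in _ <=v X]mulr1; apply: vle_mul; first exact: vle_refl.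
exact: int_integral.
Qed.

Lemma int_odd z : odd `|z| -> z%:~R =v 1.
Proof.
move=> od; apply: near1; apply: (vle_vlt_trans _ (lt2 nhalf)).
by rewrite -[1]/(1%:~R) -intrB; apply: int_even; lia.
Qed.

Lemma ratr_denq a : ratr a * (denq a)%:~R = (numq a)%:~R :> K.
Proof. by rewrite /ratr mulfVK // intr_eq0 denq_neq0. Qed.

Lemma Zloc_integral a : a \in Z_loc2 -> ratr a <=v 1.
Proof.
move=> /int_odd h; have -> : ratr a =v (numq a)%:~R.
  by rewrite -ratr_denq h mulr1; apply: veq_refl.
exact: int_integral.
Qed.

Lemma eq_mod4_vle a b : eq_mod4 a b -> ratr a - ratr b <=v 4.
Proof.
move=> [_ _ [t /Zloc_integral ht e]]; rewrite -rmorphB e rmorphM /= ratr_nat.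
by rewrite -[X in _ <=v X]mulr1; apply: vle_mul ht; apply: vle_refl.
Qed.

Lemma coprime_odd a : ~~ odd `|denq a| -> odd `|numq a|.
Proof.
have := coprime_num_den a; rewrite -!dvdn2 => cop dvd.
apply: contraT; rewrite -dvdn2 => dvd'.
by have := dvdn_gcd 2 `|numq a| `|denq a|; rewrite (eqP cop) dvd dvd'.
Qed.

Lemma logn2_eq0 n : (0 < n)%N -> (logn 2 n == 0) = odd n.
Proof.
by move=> n0; rewrite -leqn0 leqNgt logn_gt0 mem_primes n0 /= dvdn2 negbK.
Qed.

Lemma v2_lt0 a : (v2 a < 0) = ~~ odd `|denq a|.
Proof.
have d0 : (0 < `|denq a|)%N by rewrite absz_gt0 denq_neq0.
have [od|ev] := boolP (odd `|denq a|).
  have /eqP e : logn 2 `|denq a| == 0 by rewrite logn2_eq0.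
  by rewrite /v2 e subr0 ltNge.
have on := coprime_odd ev.
have n0 : (0 < `|numq a|)%N by case: `|numq a|%N on.
have /eqP en : logn 2 `|numq a| == 0 by rewrite logn2_eq0.
have dn : (0 < logn 2 `|denq a|)%N by rewrite lt0n logn2_eq0.
by rewrite /v2 en sub0r oppr_lt0.
Qed.

Lemma int_F2 z : z%:~R = (odd `|z|)%:R :> 'F_2.
Proof.
have nat_F2 n : n%:R = (odd n)%:R :> 'F_2.
  rewrite -[n in LHS]odd_double_half natrD -muln2 natrM pchar_Zp //.
  by rewrite mulr0 addr0.
case: z => n; first exact: nat_F2.
rewrite NegzE abszN absz_nat intrN [(_%:~R)]nat_F2.
by case: odd; apply: val_inj.
Qed.

Lemma rhoE a : rho a =
  if odd `|denq a| then Some (odd `|numq a|)%:R else None.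
Proof.
rewrite /rho v2_lt0; case: ifP => [/negPf ->//|/negbFE od]; rewrite od.
by rewrite /ratr !int_F2 od invr1 mulr1.
Qed.

Lemma ratr_pole a : ~~ odd `|denq a| -> 1 <v ratr a.
Proof.
move=> ev h; apply: (lt2 nhalf).
rewrite -{1}(int_odd (coprime_odd ev)) -ratr_denq -[X in _ <=v X]mul1r.
by apply: vle_mul h _; apply: int_even.
Qed.

Lemma ratr_even a : odd `|denq a| -> ~~ odd `|numq a| -> ratr a <v 1.
Proof.
move=> /int_odd od ev; apply: (vle_vlt_trans _ (lt2 nhalf)).
have -> : ratr a =v (numq a)%:~R.
  by rewrite -ratr_denq od mulr1; apply: veq_refl.
exact: int_even.
Qed.

Lemma ratr_odd a : odd `|denq a| -> odd `|numq a| -> ratr a - 1 <v 1.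
Proof.
move=> od on; apply: (vle_vlt_trans _ (lt2 nhalf)).
have -> : ratr a - 1 =v (numq a - denq a)%:~R.
  rewrite intrB -ratr_denq -[X in _ =v _ - X]mul1r -mulrBl (int_odd od) mulr1.
  exact: veq_refl.
by apply: int_even; lia.
Qed.

Lemma v2_eqN1 a : v2 a = -1 -> 2 * ratr a - 1 <v 1.
Proof.
move=> va; have ev : ~~ odd `|denq a| by rewrite -v2_lt0 va.
have on := coprime_odd ev.
have n0 : (0 < `|numq a|)%N by case: `|numq a|%N on.
have /eqP en : logn 2 `|numq a| == 0 by rewrite logn2_eq0.
have ed : logn 2 `|denq a| = 1%N by move: va; rewrite /v2 en; lia.
have [|m om em] := @pfactor_coprime 2 `|denq a| isT.
  by rewrite absz_gt0 denq_neq0.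
rewrite coprime2n in om.
have dm : (denq a)%:~R = 2 * m%:R :> K.
  by rewrite -absz_denq em ed expn1 -pmulrn natrM mulrC.
have rm : 2 * ratr a * m%:R = (numq a)%:~R :> K.
  by rewrite -ratr_denq dm; ring.
have om' : m%:R =v 1 by apply: (@int_odd m).
apply: (vle_vlt_trans _ (lt2 nhalf)).
have -> : 2 * ratr a - 1 =v (numq a - m%:Z)%:~R.
  rewrite intrB -rm -[X in _ =v _ - X]mul1r -mulrBl om' mulr1.
  exact: veq_refl.
by apply: int_even; lia.
Qed.

Lemma v2_leN2 a : v2 a <= -2 -> 1 <=v 4 * ratr a.
Proof.
move=> va; have ev : ~~ odd `|denq a|.
  by rewrite -v2_lt0; apply: le_lt_trans va _.
have on := coprime_odd ev.
have n0 : (0 < `|numq a|)%N by case: `|numq a|%N on.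
have /eqP en : logn 2 `|numq a| == 0 by rewrite logn2_eq0.
have ed : (2 <= logn 2 `|denq a|)%N by move: va; rewrite /v2 en; lia.
have : (2 ^ 2 %| `|denq a|)%N by rewrite pfactor_dvdn // absz_gt0 denq_neq0.
move=> /dvdnP[m em].
have dm : (denq a)%:~R = 4 * m%:R :> K.
  by rewrite -absz_denq em -pmulrn natrM mulrC.
have [_ num1] := int_odd on; apply: vle_trans num1 _.
rewrite -ratr_denq dm (_ : _ * _ = (4 * ratr a) * m%:R); last by ring.
rewrite -[X in _ <=v X]mulr1; apply: vle_mul; first exact: vle_refl.
exact: nat_integral.
Qed.

End DyadicRationals.

(** * Common torsion parameters *)

Section CommonTorsion.
Variables (K : numFieldType) (O : valuation_ring K).
Hypothesis nhalf : ~ O 2^-1.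
Local Notation "x <=v y" := (vle O x y) (at level 70).
Local Notation "x <v y" := (vlt O x y) (at level 70).
Local Notation "x =v y" := (veq O x y) (at level 70).
Variables (l : K) (l_neq0 : l != 0) (l_neq1 : l != 1).
Variables (a b : rat).
Hypotheses (a_neq0 : a != 0) (a_neq1 : a != 1).
Hypotheses (b_neq0 : b != 0) (b_neq1 : b != 1).
Local Notation A := (ratr a : K).
Local Notation B := (ratr b : K).
Hypotheses (tA : torsion_x l A) (tB : torsion_x l B).

Let A0 : A != 0. Proof. by rewrite fmorph_eq0. Qed.
Let A1 : A != 1. Proof. by rewrite fmorph_eq1. Qed.
Let B0 : B != 0. Proof. by rewrite fmorph_eq0. Qed.
Let B1 : B != 1. Proof. by rewrite fmorph_eq1. Qed.

Lemma lt42 : 4 <v 2.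
Proof.
rewrite (_ : 4 = 2 * 2); last by ring.
exact: (vlt_mull (lt2 nhalf) (two_neq0 nhalf)).
Qed.

Lemma lt84 : 8 <v 4.
Proof.
rewrite (_ : 8 = 2 * 4); last by ring.
exact: (vlt_mull (lt2 nhalf) (four_neq0 nhalf)).
Qed.

(** The option type encodes the three points of the projective line over the
    field with two elements, with [None] for the point at infinity. *)
Definition reduces_to (x : K) : option bool -> Prop := fun c =>
  match c with None => 1 <v x | Some e => x - e%:R <v 1 end.

Lemma torsion_reduces_to (c : rat) : c != 0 -> c != 1 -> torsion_x l (ratr c) ->
  exists2 e, rho c = omap (fun e : bool => e%:R) e & reduces_to l e.
Proof.
move=> c0 c1 tc; rewrite rhoE.
have C0 : ratr c != 0 :> K by rewrite fmorph_eq0.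
have C1 : ratr c != 1 :> K by rewrite fmorph_eq1.
have [od|ev] := boolP (odd `|denq c|); last first.
  exists None => //=; have := ratr_pole nhalf ev.
  by case/(torsion_pole nhalf l_neq0 l_neq1 tc).
exists (Some (odd `|numq c|)) => //=.
have [on|en] := boolP (odd `|numq c|).
  by apply: (torsion_odd nhalf l_neq0 l_neq1 tc) => //; apply: ratr_odd.
rewrite subr0; apply: (torsion_even nhalf l_neq0 l_neq1 tc) => //.
exact: ratr_even.
Qed.

Lemma reduces_to_inj x e e' : reduces_to x e -> reduces_to x e' -> e = e'.
Proof.
have pole_int (f : bool) : 1 <v x -> x - f%:R <v 1 -> False.
  move=> x1 xf; apply: x1; rewrite -[x](subrK f%:R); apply: vle_add.
    exact: vltW.
  by case: f {xf}; [apply: vle_refl | apply: vle0].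
have two_red : x <v 1 -> x - 1 <v 1 -> False.
  move=> x0 x1; apply: (@vltxx _ O 1).
  by rewrite {1}(_ : 1 = x - (x - 1)); [apply: vlt_sub | ring].
case: e e' => [f|] [f'|] //=; last 2 first.
- by move=> h h'; case: (pole_int _ h' h).
- by move=> h h'; case: (pole_int _ h h').
by case: f f' => [] [] //=; rewrite subr0 => h h'; case: two_red.
Qed.

Lemma common_rho : rho a = rho b.
Proof.
have [e -> he] := torsion_reduces_to a_neq0 a_neq1 tA.
have [f -> hf] := torsion_reduces_to b_neq0 b_neq1 tB.
by rewrite (reduces_to_inj he hf).
Qed.

(** For l different from b, the two values allowed for l by b satisfy
    |l - 1| <= |8|, whereas a only allows |l - 1| = |2| or |4|, or l = a^2. *)
Lemma common_odd : eq_mod4 a 3 -> eq_mod4 b 1 -> l = ratr (a ^+ 2) \/ l = B.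
Proof.
move=> /(eq_mod4_vle nhalf) ha /(eq_mod4_vle nhalf).
rewrite rmorph1 => hb; rewrite ratr_nat in ha; rewrite rmorphXn /=.
have ha' : A - 3 <v 2 by apply: vle_vlt_trans ha lt42.
have ea : A - 1 =v 2.
  by rewrite (_ : A - 1 = 2 + (A - 3)); [apply: veq_addr | ring].
have ha1 : A + 1 <=v 4.
  rewrite (_ : A + 1 = 4 + (A - 3)); last by ring.
  by apply: vle_add => //; apply: vle_refl.
have Aodd : A - 1 <v 1 by rewrite ea; apply: lt2.
have Bodd : B - 1 <v 1 by apply: vle_vlt_trans hb (lt4 nhalf).
have hb1 : B + 1 =v 2.
  rewrite (_ : B + 1 = 2 + (B - 1)); last by ring.
  by apply: veq_addr; apply: vle_vlt_trans hb lt42.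
have e8 : 8 = 2 * 4 :> K by ring.
have sqB : B ^+ 2 - 1 <=v 8.
  rewrite (_ : B ^+ 2 - 1 = (B + 1) * (B - 1)); last by ring.
  by rewrite hb1 e8; apply: vle_mul => //; apply: vle_refl.
have sqA : A ^+ 2 - 1 <=v 8.
  rewrite (_ : A ^+ 2 - 1 = (A - 1) * (A + 1)); last by ring.
  by rewrite ea e8; apply: vle_mul => //; apply: vle_refl.
have [->|nlB] := eqVneq l B; [by right | left].
have l8 : l - 1 <=v 8.
  case: (torsion_odd_sharp nhalf l_neq0 l_neq1 tB B0 B1 Bodd) => [e|->//|e].
    by rewrite e eqxx in nlB.
  rewrite (_ : l - 1 = (l - B ^+ 2) + (B ^+ 2 - 1)); last by ring.
  by apply: vle_add => //; rewrite e e8; apply: vle_mul => //; apply: vle_refl.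
case: (torsion_odd_sharp nhalf l_neq0 l_neq1 tA A0 A1 Aodd) => [e|//|e].
  case: (@vltxx _ O 8); apply: vlt_trans lt84 _; apply: vlt_vle_trans lt42 _.
  by rewrite -ea -e.
case: (@vltxx _ O 8); apply: vlt_vle_trans lt84 _.
have e4 : l - A ^+ 2 =v 4.
  by rewrite e ea (_ : 2 * 2 = 4); [apply: veq_refl | ring].
rewrite -e4 (_ : l - A ^+ 2 = (l - 1) - (A ^+ 2 - 1)); last by ring.
exact: vle_sub.
Qed.

(** For l different from b, the two values allowed for l by b satisfy
    |l| <= |8|, whereas a only allows |l| = |2| or |4|, or l = a(2-a). *)
Lemma common_even :
  eq_mod4 a 2 -> eq_mod4 b 0 -> l = ratr (a * (2 - a)) \/ l = B.
Proof.
move=> /(eq_mod4_vle nhalf) ha /(eq_mod4_vle nhalf).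
rewrite rmorph0 subr0 => hb; rewrite ratr_nat in ha.
rewrite rmorphM rmorphB /= ratr_nat.
have ha' : A - 2 <v 2 by apply: vle_vlt_trans ha lt42.
have ea : A =v 2.
  by rewrite (_ : A = 2 + (A - 2)); [apply: veq_addr | ring].
have ha2 : 2 - A <=v 4 by rewrite -opprB veq_opp.
have Aev : A <v 1 by rewrite ea; apply: lt2.
have Bev : B <v 1 by apply: vle_vlt_trans hb (lt4 nhalf).
have hb2 : 2 - B =v 2 by apply: veq_subr; apply: vle_vlt_trans hb lt42.
have e8 : 8 = 2 * 4 :> K by ring.
have sqB : B * (2 - B) <=v 8.
  by rewrite hb2 mulrC e8; apply: vle_mul => //; apply: vle_refl.
have sqA : A * (2 - A) <=v 8.
  by rewrite {1}ea e8; apply: vle_mul => //; apply: vle_refl.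
have [->|nlB] := eqVneq l B; [by right | left].
have l8 : l <=v 8.
  case: (torsion_even_sharp nhalf l_neq0 l_neq1 tB B0 Bev) => [e|->//|e].
    by rewrite e eqxx in nlB.
  rewrite (_ : l = (l - B * (2 - B)) + B * (2 - B)); last by ring.
  by apply: vle_add => //; rewrite e e8; apply: vle_mul => //; apply: vle_refl.
case: (torsion_even_sharp nhalf l_neq0 l_neq1 tA A0 Aev) => [e|//|e].
  case: (@vltxx _ O 8); apply: vlt_trans lt84 _; apply: vlt_vle_trans lt42 _.
  by rewrite -ea -e.
case: (@vltxx _ O 8); apply: vlt_vle_trans lt84 _.
have e4 : l - A * (2 - A) =v 4.
  by rewrite e ea (_ : 2 * 2 = 4); [apply: veq_refl | ring].
by rewrite -e4; apply: vle_sub.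
Qed.

(** For l different from b, one has |l| >= |b/2| >= |1/8| because of b, whereas
    a only allows |l| = |1/2| or |1/4|, or l(2a-1) = a^2; the last equation
    implies 2a <> 1 since a <> 0. *)
Lemma common_pole : v2 a = -1 -> v2 b <= -2 ->
  (a != 1 / 2 /\ l = ratr (a ^+ 2 / (2 * a - 1))) \/ l = B.
Proof.
move=> va vb.
have hA := v2_eqN1 nhalf va; have e2A := near1 hA.
have hB := v2_leN2 nhalf vb.
have Apole : 1 <v A by apply: (ratr_pole nhalf); rewrite -v2_lt0 va.
have Bpole : 1 <v B.
  by apply: (ratr_pole nhalf); rewrite -v2_lt0; apply: le_lt_trans vb _.
have [l_pole _] := torsion_pole nhalf l_neq0 l_neq1 tA Apole.
have [->|nlB] := eqVneq l B; [by right | left].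
have B2pole : 1 <v 2 * B.
  move=> h; apply: (lt2 nhalf); apply: vle_trans hB _.
  rewrite (_ : 4 * B = 2 * (2 * B)); last by ring.
  by rewrite -[X in _ <=v X]mulr1; apply: vle_mul => //; apply: vle_refl.
have e2B : 2 * B - 1 =v 2 * B by apply: veq_subr.
have lB : B <=v 2 * l.
  apply: contrapT => h; have {}h : 2 * l <v B := h.
  have {}h : l * (2 * B - 1) <v B ^+ 2.
    rewrite e2B (_ : l * (2 * B) = (2 * l) * B); last by ring.
    by rewrite expr2; apply: vlt_mul2r.
  case: (torsion_pole_sharp nhalf l_neq0 l_neq1 tB Bpole) => e.
  - by rewrite e eqxx in nlB.
  - by apply: (@vltxx _ O (B ^+ 2)); rewrite -{1}e.
  - apply: (@vltxx _ O (B ^+ 2)); apply: (vle_vlt_trans _ h).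
    rewrite e2B (_ : l * (2 * B) = 2 * (l * B)); last by ring.
    by rewrite -e -opprB veq_opp; case: (veq_subr h).
have l8 : 1 <=v 8 * l.
  apply: vle_trans hB _; rewrite (_ : 8 * l = 4 * (2 * l)); last by ring.
  by apply: vle_mul => //; apply: vle_refl.
case: (torsion_pole_sharp nhalf l_neq0 l_neq1 tA Apole) => e.
- case: (lt4 nhalf); apply: vle_trans l8 _; rewrite e.
  rewrite (_ : 8 * A = 4 * (2 * A)); last by ring.
  by rewrite e2A mulr1; apply: vle_refl.
- have d0 : 2 * A - 1 != 0.
    by apply: contraNneq A0 => d; move/esym/eqP: e; rewrite d mulr0 sqrf_eq0.
  split.
    apply: contraNneq d0 => ->.
    rewrite rmorphM rmorph1 fmorphV /= ratr_nat mul1r.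
    by rewrite mulfV ?subrr // (two_neq0 nhalf).
  by rewrite fmorph_div rmorphXn rmorphB rmorphM /= rmorph1 ratr_nat -e mulfK.
- case: (lt2 nhalf); apply: vle_trans l8 _.
  have {}e : l * (2 * A - 1) - A ^+ 2 =v l.
    rewrite e (_ : 2 * (l * A) = l * (2 * A)); last by ring.
    by rewrite e2A mulr1; apply: veq_refl.
  have lt : l * (2 * A - 1) <v l by rewrite mulrC; apply: vlt_mull.
  have eA : A ^+ 2 =v l.
    rewrite (_ : A ^+ 2 = - (l * (2 * A - 1) - A ^+ 2 - l * (2 * A - 1))).
      by rewrite veq_opp -[X in _ =v X]e; apply: veq_subr; rewrite e.
    by ring.
  rewrite -eA (_ : 8 * A ^+ 2 = 2 * (2 * A) ^+ 2); last by ring.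
  by rewrite e2A expr1n mulr1; apply: vle_refl.
Qed.

End CommonTorsion.

Local Open Scope classical_set_scope.

Theorem corollary8 (R : realType) (a b : rat)
    (a_neq0 : a != 0) (a_neq1 : a != 1) (b_neq0 : b != 0) (b_neq1 : b != 1) :
  let T : set R[i] := common_torsion_params (ratr a) (ratr b) in
  [/\ rho a != rho b -> T = set0,
      eq_mod4 a 3 -> eq_mod4 b 1 -> T `<=` [set ratr (a ^+ 2); ratr b],
      eq_mod4 a 2 -> eq_mod4 b 0 -> T `<=` [set ratr (a * (2 - a)); ratr b] &
      v2 a = -1 -> v2 b <= -2 ->
        T `<=` [set l | a != 1 / 2 /\ l = ratr (a ^+ 2 / (2 * a - 1))]
               `|` [set ratr b]].
Proof.
have [O nhalf] := dyadic_valuation_ring R[i].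
move=> T; split.
- move=> /eqP nab; apply/seteqP; split=> // l [[l0 l1 ta] [_ _ tb]].
  by case: nab; apply: (common_rho nhalf l0 l1).
- by move=> ha hb l [[l0 l1 ta] [_ _ tb]]; apply: (common_odd nhalf l0 l1).
- by move=> ha hb l [[l0 l1 ta] [_ _ tb]]; apply: (common_even nhalf l0 l1).
- by move=> ha hb l [[l0 l1 ta] [_ _ tb]]; apply: (common_pole nhalf l0 l1).
Qed.
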